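(* Let $I\subset\mathbb{R}$ be a bounded interval, $\delta\ge 1$, and $w\in RH_\infty^{\delta}(I)$. (i) For every $q\in(1,\infty)$, $$\sup_{J\subset I}\ \langle w\rangle_J\,\langle w^{1-q'}\rangle_J^{\,q-1}\le C_q(\infty,\delta),\qquad C_q(\infty,\delta)=\begin{cases}+\infty, & 1<q\le\delta,\\[2pt] \dfrac{1}{\delta}\left(\dfrac{q-1}{q-\delta}\right)^{q-1}, & q>\delta.\end{cases}$$ (ii) $$\sup_{J\subset I}\ \langle w\rangle_J\exp\bigl(-\langle\log w\rangle_J\bigr)\le C_\infty(\infty,\delta),\qquad C_\infty(\infty,\delta)=\frac{1}{\delta}\exp(\delta-1).$$ Here the suprema are over all subintervals $J\subset I$. Moreover, the constants $C_q(\infty,\delta)$ and $C_\infty(\infty,\delta)$ are best possible: for fixed $I,\delta$ (and $q$), no smaller constant makes the corresponding inequality hold for all $w\in RH_\infty^{\delta}(I)$.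
   Context: A weight on an interval $I$ is a non-negative measurable function on $I$. For a (bounded, non-degenerate) interval $J$, $|J|$ is its length and $\langle f\rangle_J=\frac{1}{|J|}\int_J f(t)\,dt$. The conjugate exponent of $q\in(1,\infty)$ is $q'=\frac{q}{q-1}$. Negative powers of $0$ are $+\infty$. For $\delta\ge1$, $RH_\infty^{\delta}(I)$ is the class of weights $w$ on $I$ such that $0<\langle w\rangle_J<\infty$ and $\dfrac{\operatorname{ess\,sup}_J w}{\langle w\rangle_J}\le\delta$ for every subinterval $J\subset I$. *)

(* Defs.v *)
From HB Require Import structures.
From mathcomp Require Import all_boot all_order all_algebra.
From mathcomp Require Import all_classical all_reals all_analysis.
From mathcomp Require Import ess_sup_inf.
Set Implicit Arguments.
Unset Strict Implicit.
Unset Printing Implicit Defensive.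
Import Order.TTheory GRing.Theory Num.Theory.
Import numFieldNormedType.Exports.
Local Open Scope classical_set_scope.
Local Open Scope ring_scope.
Local Open Scope ereal_scope.

(* Endpoints may or may not belong to the interval. *)
Definition bounded_interval (R : realType) (J : set R) : Prop :=
  [/\ is_interval J, bounded_set J &
      exists x y : R, [/\ J x, J y & (x < y)%R]].

Definition subinterval (R : realType) (I J : set R) : Prop :=
  bounded_interval J /\ J `<=` I.

(* The real line with its Lebesgue sigma-algebra (Caratheodory-measurable sets),
   the one on which completed_lebesgue_measure is a measure; the default
   sigma-algebra on R : realType is the Borel one. *)
Definition lebesgue_line (R : realType) :=
  caratheodory_type (@wlength R idfun)^*%mu.

(* Lebesgue measurability; only the values of w on I matter. *)
Definition weight (R : realType) (I : set R) (w : R -> R) : Prop :=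
  measurable_fun (I : set (lebesgue_line R)) (w : lebesgue_line R -> R) /\
  (forall x, I x -> (0 <= w x)%R).

Definition avg (R : realType) (J : set R) (f : R -> \bar R) : \bar R :=
  (@completed_lebesgue_measure R J)^-1 *
  \int[@completed_lebesgue_measure R]_(t in J) f t.

(* The library's ess_sup is taken over the whole line; the value -oo outside J
   makes the points outside J irrelevant. *)
Definition ess_sup_on (R : realType) (J : set R) (f : R -> \bar R) : \bar R :=
  ess_sup (@completed_lebesgue_measure R) (patch (fun=> -oo) J f).

Definition RHinfty (R : realType) (I : set R) (delta : R) (w : R -> R) : Prop :=
  weight I w /\
  forall J, subinterval I J ->
    0 < avg J (EFin \o w) < +oo /\
    ess_sup_on J (EFin \o w) / avg J (EFin \o w) <= delta%:E.

(* The library's powR sends 0 to 0 under a negative exponent; here negative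
   powers of 0 are +oo. *)
Definition wpow (R : realType) (a p : R) : \bar R :=
  if (a == 0%R) && (p < 0)%R then +oo else (a `^ p)%:E.

Definition conj_exp (R : realType) (q : R) : R := (q / (q - 1))%R.

Definition Aq_sup (R : realType) (I : set R) (q : R) (w : R -> R) : \bar R :=
  ereal_sup [set avg J (EFin \o w) *
                 poweR (avg J (fun x => wpow (w x) (1 - conj_exp q))) (q - 1)
            | J in subinterval I].

(* lne 0 = -oo *)
Definition Ainfty_sup (R : realType) (I : set R) (w : R -> R) : \bar R :=
  ereal_sup [set avg J (EFin \o w) * expeR (- avg J (fun x => lne (w x)%:E))
            | J in subinterval I].

(* Meaningful for 1 < q. *)
Definition Cq (R : realType) (q delta : R) : \bar R :=
  if (q <= delta)%R then +oo
  else (delta^-1 * ((q - 1) / (q - delta)) `^ (q - 1))%:E.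

Definition Cinfty (R : realType) (delta : R) : \bar R :=
  (delta^-1 * expR (delta - 1))%:E.

(* Main.v *)
Require Import Defs.
From HB Require Import structures.
From mathcomp Require Import all_boot all_order all_algebra.
From mathcomp Require Import all_classical all_reals all_analysis.
From mathcomp Require Import ess_sup_inf measurable_realfun.
From mathcomp Require Import lebesgue_stieltjes_measure ring lra.
Import Order.TTheory GRing.Theory Num.Theory.
Import numFieldNormedType.Exports.
Local Open Scope classical_set_scope.
Local Open Scope ring_scope.

(** Write W for the average of w over J and L = delta W.  The heart of the proof
    is that, for 0 <= l <= L,
      (1)  int_{J, w < l} (delta w - l) >= 0.
    Put h = delta w - l and F = {w >= l}.  A subinterval meeting F in positive
    measure has essential supremum at least l, so RH_oo makes the integral of h
    over it nonnegative.  Cover {w < l} in J by finitely many intervals up to a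
    small error.  Each can be enlarged, inside {w < l} up to a null set, until it
    is adjacent to F or fills J, and then the integral of h over it is nonnegative by
    continuity.

    Integrating (1) against l^(-p-2) dl, with p = 1/(q-1), and using w <= L
    almost everywhere, gives (p + 1 - delta p) <w^-p> <= L^-p, which is (i).  The
    case p = 0, with a logarithm, is (ii).  The integration in l is replaced by a
    telescoping sum over finer and finer subdivisions, applied to w truncated
    from below, and the truncation is removed by monotone convergence.

    Sharpness: for w(t) = (t - inf I)^(d-1) with 1 <= d <= delta, the choice
    J = I gives the bound with delta replaced by d.  For q <= delta one lets d
    increase to q. *)

(** * Lebesgue measure and integrals over open intervals *)

(** The set {w < l} is merely measurable, so it has no component intervals to which RH_oo could be
    applied one by one; hence the covering and its error terms. The kernel l^(-p-2) is dictated by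
    the target: for 0 < u <= L, the integral of (delta u - l) l^(-p-2) over u < l < L is a
    combination of u^(-p), u and a constant. The coefficient of u^(-p) has the sign of delta p - (p
    + 1), and p + 1 - delta p = (q - delta)/(q - 1): this is the threshold q > delta. The
    coefficient of u is negative, so a lower bound for the integral of u suffices. Nothing is lost
    for w(t) = (t - inf I)^(delta-1) with delta > 1 and J = I: there {w < l} is an initial interval
    on which delta times the average is exactly l, so (1) is an equality for every l in (0, L].
    Truncating from below at e keeps the primitives of the kernel bounded and preserves (1): for l >
    e the set {w < l} is unchanged and w can only grow on it. *)

Section lebesgue_line.
Context {R : realType}.
Notation T := (lebesgue_line R).
Notation mu := (@completed_lebesgue_measure R).

Lemma lebesgue_line_borel (A : set R) :
  measurable A -> measurable (A : set T).
Proof. by move=> mA; exact: sub_caratheodory. Qed.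

(** Both sides are the same outer measure, so the equality holds by conversion, for every set. *)
Lemma completed_borel (A : set R) : mu A = lebesgue_measure A.
Proof. by []. Qed.

Lemma lebesgue_line_id : measurable_fun [set: T] (idfun : T -> measurableTypeR R).
Proof. by move=> _ Z mZ; rewrite setTI; exact: lebesgue_line_borel. Qed.

Lemma lebesgue_line_funT d (Y : measurableType d) (f : R -> Y) :
  measurable_fun setT f -> measurable_fun (setT : set T) (f : T -> Y).
Proof.
by move=> mf; exact: (measurableT_comp (mf : measurable_fun setT (f : measurableTypeR R -> Y)) lebesgue_line_id).
Qed.

(** The identity from the Lebesgue line to the Borel line pushes [mu] forward to [lebesgue_measure].
    This gives access to the fundamental theorem of calculus for the power weights. *)
Lemma integral_completed (D : set R) (f : R -> \bar R) :
  measurable D -> measurable_fun D f -> (forall x, D x -> 0 <= f x)%E ->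
  (\int[mu]_(x in D) f x = \int[lebesgue_measure]_(x in D) f x)%E.
Proof.
move=> mD mf f0.
have := @ge0_integral_pushforward _ _ _ (measurableTypeR R) R _ lebesgue_line_id mu D f mD mf.
move=> <-; last by move=> x; rewrite inE; exact: f0.
apply: eq_measure_integral; first exact: lebesgue_line_id.
by move=> ? A mA AD.
Qed.

Lemma measurable_lline_itv (i : interval R) : measurable ([set` i] : set T).
Proof. by apply: lebesgue_line_borel; exact: measurable_itv. Qed.

Lemma mu_oo (a b : R) : a <= b -> mu `]a, b[%classic = (b - a)%:E.
Proof.
move=> ab; rewrite completed_borel lebesgue_measure_itv/= lte_fin.
by move: ab; rewrite le_eqVlt => /predU1P[->|->//]; rewrite ltxx subrr.
Qed.

(** Measurability and boundedness on the whole line make integrability on every bounded interval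
    automatic, so that real-valued integrals can be split and compared freely. *)
Record bmeas (f : R -> R) : Prop := Bmeas {
  bmeas_measurable : measurable_fun [set: T] (f : T -> R) ;
  bmeas_bounded : exists M, forall x, `|f x| <= M }.

Lemma bmeas_integrable (D : set R) f : measurable (D : set T) ->
  (mu D < +oo)%E -> bmeas f -> mu.-integrable D (EFin \o f).
Proof.
move=> mD D_fin [mf [M fM]]; apply: measurable_bounded_integrable => //.
  exact: measurable_funS mf.
exists M; split; first exact: num_real.
by move=> x Mx y Dy; exact: le_trans (fM y) (ltW Mx).
Qed.

Lemma mu_oo_fin (a b : R) : (mu `]a, b[%classic < +oo)%E.
Proof.
rewrite completed_borel lebesgue_measure_itv/= lte_fin.
by case: ifPn => // _; rewrite -EFinD ltry.
Qed.

Lemma bmeas_int f a b : bmeas f -> mu.-integrable `]a, b[%classic (EFin \o f).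
Proof.
by apply: bmeas_integrable; [exact: measurable_lline_itv|exact: mu_oo_fin].
Qed.

Lemma mu_set1 (a : R) : mu [set a] = 0%E.
Proof. by rewrite completed_borel lebesgue_measure_set1. Qed.

Lemma int_split f a c b : bmeas f -> a <= c -> c <= b ->
  \int[mu]_(t in `]a, b[) f t =
  \int[mu]_(t in `]a, c[) f t + \int[mu]_(t in `]c, b[) f t.
Proof.
move=> bf ac cb.
have eqU : `]a, c[%classic `|` `]c, b[%classic = `]a, b[%classic `\ c.
  apply/seteqP; split => t /=; rewrite !in_itv/=.
    move=> [/andP[at_ tc]|/andP[ct tb]]; split.
    - by rewrite at_ (lt_le_trans tc).
    - by move=> tE; rewrite tE ltxx in tc.
    - by rewrite (le_lt_trans ac ct).
    - by move=> tE; rewrite tE ltxx in ct.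
  by move=> [/andP[-> ->] /eqP]; rewrite neq_lt => /orP[] ->; [left|right].
have mU : measurable (`]a, c[%classic `|` `]c, b[%classic : set T).
  by apply: measurableU; exact: measurable_lline_itv.
have inU : mu.-integrable (`]a, c[%classic `|` `]c, b[%classic) (EFin \o f).
  apply: integrableS (bmeas_int f a b bf) => //; first exact: measurable_lline_itv.
  by rewrite eqU; exact: subDsetl.
rewrite -Rintegral_setU//; [|exact: measurable_lline_itv..|].
  rewrite /Rintegral (@negligible_integral _ _ _ mu _ [set c])//.
  - by rewrite -eqU.
  - by apply: lebesgue_line_borel; exact: measurable_set1.
  - exact: measurable_lline_itv.
  - exact: bmeas_int.
  - exact: mu_set1.
apply/disj_setPS => t /=; rewrite !in_itv/= => -[/andP[_ tc] /andP[ct _]].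
by move: (lt_trans tc ct); rewrite ltxx.
Qed.

Lemma int_le f g a b : bmeas f -> bmeas g ->
  (forall t, t \in `]a, b[ -> f t <= g t) ->
  \int[mu]_(t in `]a, b[) f t <= \int[mu]_(t in `]a, b[) g t.
Proof.
move=> bf bg fg; apply: le_Rintegral; [exact: measurable_lline_itv|exact: bmeas_int..|].
by move=> x; exact: fg.
Qed.

Lemma int_cst (C : R) a b : a <= b -> \int[mu]_(t in `]a, b[) C = C * (b - a).
Proof.
by move=> ab; rewrite Rintegral_cst/= ?[X in fine X]mu_oo//; exact: measurable_lline_itv.
Qed.

Lemma bmeas_cst (C : R) : bmeas (fun=> C).
Proof. by split; [exact: measurable_cst|exists `|C|]. Qed.

Lemma int_le_cst f (C : R) a b : a <= b -> bmeas f -> (forall t, f t <= C) ->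
  \int[mu]_(t in `]a, b[) f t <= C * (b - a).
Proof. by move=> ab bf fC; rewrite -int_cst//; apply: int_le => //; exact: bmeas_cst. Qed.

Lemma int_le0 f a b : bmeas f -> mu (`]a, b[%classic `&` [set t | 0 < f t]) = 0%E ->
  \int[mu]_(t in `]a, b[) f t <= 0.
Proof.
move=> bf f0; have mab := measurable_lline_itv `]a, b[.
have mN : measurable (`]a, b[%classic `&` [set t | 0 < f t] : set T).
  have -> : [set t | 0 < f t] = f @^-1` `]0, +oo[%classic.
    by apply/seteqP; split=> t /=; rewrite in_itv/= andbT.
  apply: (measurable_funS _ _ (bmeas_measurable f bf)) => //.
rewrite /Rintegral (negligible_integral mN mab _ f0)//; last exact: bmeas_int.
have mDN : measurable (`]a, b[%classic `\` (`]a, b[%classic `&` [set t | 0 < f t]) : set T).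
  exact: measurableD.
have finDN : (mu (`]a, b[%classic `\` (`]a, b[%classic `&` [set t | (0 < f t)%R])) < +oo)%E.
  apply: le_lt_trans (mu_oo_fin a b); apply: le_measure; rewrite ?inE//; exact: subDsetl.
rewrite -/(Rintegral mu _ f) (le_trans (le_Rintegral mDN (bmeas_integrable _ f mDN finDN bf)
  (bmeas_integrable _ _ mDN finDN (bmeas_cst 0)) _))//.
- by move=> t [tab /= /not_andP[//|/negP]]; rewrite -leNgt.
- by rewrite Rintegral_cst// mul0r.
Qed.

End lebesgue_line.

(** Clips []c, d]] to [[x, y]]. If the two are disjoint, [c0 = d0] is an endpoint, which spares the
    caller a case distinction. *)
Lemma clamp_itv (R : realFieldType) (c d x y : R) : c < d -> x <= y ->
  exists c0 d0, [/\ [/\ x <= c0, c0 <= d0 & d0 <= y],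
    (forall t, x < t -> t < c0 -> t \notin `]c, d]),
    (forall t, d0 < t -> t < y -> t \notin `]c, d]) &
    (forall t, c0 < t -> t <= d0 -> t < y -> t \in `]c, d])].
Proof.
move=> cd xy; exists (Num.max x (Num.min c y)), (Num.max x (Num.min d y)); split.
- by split; rewrite ?le_max ?ge_max ?le_min ?ge_min ?lexx ?xy ?orbT ?(ltW cd)//=; lra.
- move=> t xt; rewrite lt_max lt_min in_itv/= => /orP[tx|/andP[tc _]].
    by rewrite ltNge (ltW tx) in xt.
  by rewrite ltNge (ltW tc).
- move=> t; rewrite gt_max gt_min in_itv/= => /andP[xt /orP[dt|yt]] ty.
    by rewrite [t <= d]leNgt dt andbF.
  by rewrite ltNge (ltW yt) in ty.
- move=> t; rewrite gt_max gt_min le_max le_min in_itv/= => /andP[xt ct] td ty.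
  move: ct td; rewrite [y < t]ltNge (ltW ty) orbF => ->/=.
  by rewrite leNgt xt/= => /andP[].
Qed.

(** The last conclusion matters: a strict step to the left of the point found by [trim_left] is what
    picks up mass of [F]. *)
Lemma approach_left (R : realFieldType) (x c e : R) : 0 < e -> x <= c ->
  exists t, [/\ x <= t, t <= c, c - t <= e & x < c -> t < c].
Proof.
move=> e0 xc; have [cxe|exc] := leP (c - x) e; first by exists x.
by exists (c - e); split; lra.
Qed.

Lemma approach_right (R : realFieldType) (d y e : R) : 0 < e -> d <= y ->
  exists s, [/\ d <= s, s <= y, s - d <= e & d < y -> d < s].
Proof.
move=> e0 dy; have [dye|edy] := leP (y - d) e; first by exists y.
by exists (d + e); split; lra.
Qed.

Lemma mulr_half_split (R : realFieldType) (C e : R) : 0 < C ->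
  e = C * (e / (2 * C)) + C * (e / (2 * C)).
Proof. by move=> C0; field; rewrite gt_eqF. Qed.

(** * Intervals meeting a superlevel set *)

Section rising_sun.
Context {R : realType}.
Notation T := (lebesgue_line R).
Notation mu := (@completed_lebesgue_measure R).

Lemma bmeas_if (p : R -> bool) (f g : R -> R) :
  measurable_fun [set: T] (p : T -> bool) -> bmeas f -> bmeas g ->
  bmeas (fun t => if p t then f t else g t).
Proof.
move=> mp [mf [M fM]] [mg [N gN]]; split; first exact: measurable_fun_ifT.
exists (Num.max M N) => x; rewrite le_max; case: (p x); first by rewrite fM.
by rewrite gN orbT.
Qed.

(** The sets need not be measurable: [mu] is defined on all sets, as the outer measure of
    [wlength idfun]. *)
Lemma mu_mono (A B : set R) : A `<=` B -> (mu A <= mu B)%E.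
Proof. by move=> AB; have := le_outer_measure (wlength (R:=R) idfun)^*%mu; exact. Qed.

Lemma muU_le (A B : set R) : (mu (A `|` B) <= mu A + mu B)%E.
Proof. exact: (outer_measureU2 (wlength (R:=R) idfun)^*%mu). Qed.

Lemma mu_gt0 (A : set R) : mu A <> 0%E -> (0 < mu A)%E.
Proof. by move=> /eqP A0; rewrite lt0e A0/=; exact: (outer_measure_ge0 (wlength (R:=R) idfun)^*%mu). Qed.

Lemma mu_oc (a b : R) : a <= b -> mu `]a, b]%classic = (b - a)%:E.
Proof.
move=> ab; rewrite completed_borel lebesgue_measure_itv/= lte_fin.
by move: ab; rewrite le_eqVlt => /predU1P[->|->//]; rewrite ltxx subrr.
Qed.

Lemma mu_co (a b : R) : a <= b -> mu `[a, b[%classic = (b - a)%:E.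
Proof.
move=> ab; rewrite completed_borel lebesgue_measure_itv/= lte_fin.
by move: ab; rewrite le_eqVlt => /predU1P[->|->//]; rewrite ltxx subrr.
Qed.

Lemma mu_eq0_small (A : set R) :
  (forall e : R, 0 < e -> (mu A <= e%:E)%E) -> mu A = 0%E.
Proof.
move=> A_small; apply/eqP; rewrite eq_le; apply/andP; split; last exact: (outer_measure_ge0 (wlength (R:=R) idfun)^*%mu).
by apply/lee_addgt0Pr => e e0; rewrite add0e; exact: A_small.
Qed.

(** Moves [c] to the left until [F] is met in positive measure: [c1] is the infimum of the [t] for
    which [F] is null in []t, c[]. [F] is still null in []c1, c[], because it is null in []s, c[]
    for such [s] arbitrarily close to [c1], and []c1, s]] is short. *)
Lemma trim_left (F : set R) x c : x <= c ->
  exists c1, [/\ x <= c1, c1 <= c, mu (F `&` `]c1, c[) = 0%E &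
    c1 = x \/ x < c1 /\ forall t, x <= t -> t < c1 -> (0 < mu (F `&` `]t, c[))%E].
Proof.
move=> xc; pose A := [set t | x <= t <= c /\ mu (F `&` `]t, c[) = 0%E].
have Ac : A c.
  by split; [rewrite xc lexx|rewrite set_itv_ge ?bnd_simp ?ltxx// setI0; exact: (outer_measure0 (wlength (R:=R) idfun)^*%mu)].
have lbA : lbound A x by move=> t [/andP[]].
have hA : has_inf A by split; [exists c|exists x].
exists (inf A); split.
- by apply: lb_le_inf => //; exists c.
- by apply: ge_inf => //; exists x.
- apply: mu_eq0_small => e e0; have [s [/andP[xs sc] s0] se] := inf_adherent e0 hA.
  have As : inf A <= s by apply: ge_inf; [exists x|split=> //; rewrite xs].
  apply: (@le_trans _ _ (mu (`]inf A, s] `|` (F `&` `]s, c[)))).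
    apply: mu_mono => t /= [Ft]; rewrite !in_itv/= => /andP[At tc].
    by case: (leP t s) => ts; [left; rewrite At|right; rewrite tc].
  apply: (le_trans (muU_le _ _)); rewrite mu_oc// s0 adde0 lee_fin.
  by rewrite lerBlDl ltW.
- have [->|Ax] := eqVneq (inf A) x; [by left|right; split].
    by rewrite lt_neqAle eq_sym Ax; apply: lb_le_inf => //; exists c.
  move=> t xt tA; apply: mu_gt0 => t0.
  have : inf A <= t.
    apply: ge_inf; [by exists x|split=> //; rewrite xt/=].
    by rewrite (le_trans (ltW tA))//; apply: ge_inf => //; exists x.
  by rewrite leNgt tA.
Qed.

(** Mirror image of [trim_left], with a supremum. *)
Lemma trim_right (F : set R) d y : d <= y ->
  exists d1, [/\ d <= d1, d1 <= y, mu (F `&` `]d, d1[) = 0%E &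
    d1 = y \/ d1 < y /\ forall t, t <= y -> d1 < t -> (0 < mu (F `&` `]d, t[))%E].
Proof.
move=> dy; pose A := [set t | d <= t <= y /\ mu (F `&` `]d, t[) = 0%E].
have Ad : A d.
  by split; [rewrite dy lexx|rewrite set_itv_ge ?bnd_simp ?ltxx// setI0; exact: (outer_measure0 (wlength (R:=R) idfun)^*%mu)].
have ubA : ubound A y by move=> t [/andP[]].
have hA : has_sup A by split; [exists d|exists y].
exists (sup A); split.
- by apply: ub_le_sup => //; exists y.
- by apply: ge_sup => //; exists d.
- apply: mu_eq0_small => e e0; have [s [/andP[ds sy] s0] se] := sup_adherent e0 hA.
  have As : s <= sup A by apply: ub_le_sup; [exists y|split=> //; rewrite ds].
  apply: (@le_trans _ _ (mu (`[s, sup A[ `|` (F `&` `]d, s[)))).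
    apply: mu_mono => t /= [Ft]; rewrite !in_itv/= => /andP[dt tA].
    by case: (leP s t) => ts; [left; rewrite tA|right; rewrite dt].
  apply: (le_trans (muU_le _ _)); rewrite mu_co// s0 adde0 lee_fin.
  by rewrite lerBlDl -lerBlDr ltW.
- have [->|Ay] := eqVneq (sup A) y; [by left|right; split].
    by rewrite lt_neqAle Ay; apply: ge_sup => //; exists d.
  move=> t ty tA; apply: mu_gt0 => t0.
  have : t <= sup A.
    apply: ub_le_sup; [by exists y|split=> //; rewrite ty andbT].
    by rewrite (le_trans _ (ltW tA))//; apply: ub_le_sup => //; exists y.
  by rewrite leNgt tA.
Qed.

Section induction.
Variables (h : R -> R) (F : set R) (lam C a b : R) (c d : nat -> R).
Hypotheses (bh : bmeas h) (mF : measurable (F : set T)).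
Hypotheses (lam0 : 0 <= lam) (C0 : 0 < C).
Hypotheses (hlam : forall t, - lam <= h t) (hC : forall t, h t <= C).
Hypothesis goodF : forall x y, a <= x -> x < y -> y <= b ->
  (0 < mu (F `&` `]x, y[))%E -> 0 <= \int[mu]_(t in `]x, y[) h t.

(* The value [- lam] off [F] makes [masked 0 <= h], which starts the induction
   on the number of removed intervals. *)
Fixpoint masked (N : nat) (t : R) : R :=
  if N is n.+1 then
    if t \in `]c n, d n] then 0 else masked n t
  else if t \in F then h t else - lam.

Lemma measurable_pred (A : set R) : measurable (A : set T) ->
  measurable_fun [set: T] ((fun t => t \in A) : T -> bool).
Proof.
move=> mA; apply: (measurable_fun_bool true); rewrite setTI.
by rewrite (_ : _ @^-1` _ = A)//; apply/seteqP; split=> t /=; [move/set_mem|move/mem_set].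
Qed.

Lemma bmeas_masked N : bmeas (masked N).
Proof.
elim: N => [|N IH] /=.
  by apply: bmeas_if; [exact: measurable_pred|exact: bh|exact: bmeas_cst].
apply: bmeas_if; [|exact: bmeas_cst|exact: IH].
rewrite (_ : (fun _ => _) = (fun t => t \in `]c N, d N]%classic)).
  exact: measurable_pred (measurable_lline_itv _).
by apply/funext => t; rewrite mem_setE.
Qed.

Lemma masked_gt0 N t : 0 < masked N t -> F t.
Proof.
elim: N => [|N IH] /=; last by case: ifP => //; rewrite ltxx.
by case: ifPn; rewrite ?inE// oppr_gt0 ltNge lam0.
Qed.

(** Quantifying over all []x, y[] lets the induction hypothesis be applied on both sides of the
    enlarged last interval []c1, d1[]. Each outer piece is either empty or carries mass of [F] next
    to [c1] or [d1], hence satisfies the hypothesis. On []c1, d1[] the masked function is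
    nonpositive almost everywhere, whereas [h] has nonnegative integral. *)
Lemma masked_le N x y : a <= x -> x <= y -> y <= b ->
  0 <= \int[mu]_(t in `]x, y[) h t ->
  \int[mu]_(t in `]x, y[) masked N t <= \int[mu]_(t in `]x, y[) h t.
Proof.
elim: N x y => [|N IH] x y ax xy yb good.
  apply: int_le; [exact: bmeas_masked|exact: bh|].
  by move=> t _ /=; case: ifPn => // _; exact: hlam.
have [dc|cd] := leP (d N) (c N).
  have <- : masked N = masked N.+1 by apply/funext => t /=; rewrite itv_ge// bnd_simp -leNgt.
  exact: IH.
have [c0 [d0 [[xc0 cd0 dy0] Ileft Iright Imid]]] := clamp_itv _ _ _ _ _ cd xy.
have [c1 [xc1 c10 Fc c1P]] := trim_left F _ _ xc0.
have [d1 [d01 d1y Fd d1P]] := trim_right F _ _ dy0.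
have cd1 : c1 <= d1 := le_trans c10 (le_trans cd0 d01).
(* [F] has mass arbitrarily close to [c1] on the left and to [d1] on the right
   (unless they are endpoints), so slightly larger intervals are good. *)
have mid : 0 <= \int[mu]_(t in `]c1, d1[) h t.
  apply/ler_addgt0Pr => e e0; have eta0 : 0 < e / (2 * C) by rewrite divr_gt0// mulr_gt0.
  have [t [xt tc1 ct tlt]] := approach_left _ _ _ _ eta0 xc1.
  have [s [d1s sy sd slt]] := approach_right _ _ _ _ eta0 d1y.
  have at_ := le_trans ax xt; have sb := le_trans sy yb.
  have td1 := le_trans tc1 cd1; have c1s := le_trans cd1 d1s.
  have good_ts : 0 <= \int[mu]_(z in `]t, s[) h z.
    have [c1x|[xc Ft]] := c1P.
      have tx : t = x by apply/eqP; rewrite eq_le xt -c1x tc1.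
      have [d1y'|[dy Fs]] := d1P.
        (* Neither end was stopped by [F], so []t, s[] is []x, y[] itself and the hypothesis on []x,
           y[] applies. *)
        suff -> : s = y by rewrite tx.
        by apply/eqP; rewrite eq_le sy -d1y' d1s.
      have s1 := slt dy.
      apply: goodF => //; first exact: le_lt_trans td1 s1.
      apply: lt_le_trans (Fs _ sy s1) _; apply: mu_mono => z [Fz] /=.
      rewrite !in_itv/= => /andP[dz ->]; split=> //; rewrite andbT.
      exact: le_lt_trans (le_trans tc1 (le_trans c10 cd0)) dz.
    have t1 := tlt xc.
    apply: goodF => //; first exact: lt_le_trans t1 c1s.
    apply: lt_le_trans (Ft _ xt t1) _; apply: mu_mono => z [Fz] /=.
    rewrite !in_itv/= => /andP[-> zc]; split=> //=.
    exact: lt_le_trans zc (le_trans cd0 (le_trans d01 d1s)).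
  (* The slivers []t, c1[] and []d1, s[] have length at most [e / (2 * C)] and [h <= C] on them, so
     removing them costs at most [e]. *)
  apply: (le_trans good_ts); rewrite (int_split _ t c1 s bh)// (int_split _ c1 d1 s bh)//.
  rewrite addrCA lerD2l [e](_ : _ = C * (e / (2 * C)) + C * (e / (2 * C))).
    apply: lerD.
      by apply: le_trans (int_le_cst _ C _ _ tc1 bh hC) _; rewrite ler_pM2l.
    by apply: le_trans (int_le_cst _ C _ _ d1s bh hC) _; rewrite ler_pM2l.
  exact: mulr_half_split C0.
have left_le : \int[mu]_(t in `]x, c1[) masked N.+1 t <= \int[mu]_(t in `]x, c1[) h t.
  apply: (@le_trans _ _ (\int[mu]_(t in `]x, c1[) masked N t)).
    apply: int_le; [exact: bmeas_masked..|move=> t; rewrite in_itv/= => /andP[xt tc1]].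
    by rewrite (negbTE (Ileft _ xt (lt_le_trans tc1 c10))).
  apply: IH => //; first by rewrite (le_trans (le_trans cd1 d1y)).
  case: c1P => [->|[xc Fc1]]; first by rewrite set_itv_ge ?bnd_simp ?ltxx// Rintegral_set0.
  apply: goodF => //; first by rewrite (le_trans (le_trans cd1 d1y)).
  (* If [F] were null in []x, c1[] it would be null in []x, c0[], against the choice of [c1]. *)
  have := Fc1 _ (lexx x) xc; apply: contraTT; rewrite -!leNgt => Fx.
  apply: (@le_trans _ _ (mu ((F `&` `]x, c1[) `|` ([set c1] `|` (F `&` `]c1, c0[))))).
    apply: mu_mono => z [Fz] /=; rewrite !in_itv/= => /andP[xz zc0].
    have [zc1|c1z|->] := ltgtP z c1; [left|right; right|right; left] => //.
    by rewrite xz.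
  apply: (le_trans (muU_le _ _)); rewrite -[leRHS]adde0; apply: leeD => //.
  by apply: (le_trans (muU_le _ _)); rewrite Fc mu_set1 adde0.
have right_le : \int[mu]_(t in `]d1, y[) masked N.+1 t <= \int[mu]_(t in `]d1, y[) h t.
  apply: (@le_trans _ _ (\int[mu]_(t in `]d1, y[) masked N t)).
    apply: int_le; [exact: bmeas_masked..|move=> t; rewrite in_itv/= => /andP[dt ty]].
    by rewrite (negbTE (Iright _ (le_lt_trans d01 dt) ty)).
  apply: IH => //; first by rewrite (le_trans ax)// (le_trans xc1).
  case: d1P => [->|[dy Fd1]]; first by rewrite set_itv_ge ?bnd_simp ?ltxx// Rintegral_set0.
  apply: goodF => //; first by rewrite (le_trans ax)// (le_trans xc1).
  have := Fd1 _ (lexx y) dy; apply: contraTT; rewrite -!leNgt => Fy.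
  apply: (@le_trans _ _ (mu ((F `&` `]d1, y[) `|` ([set d1] `|` (F `&` `]d0, d1[))))).
    apply: mu_mono => z [Fz] /=; rewrite !in_itv/= => /andP[dz zy].
    have [zd1|d1z|->] := ltgtP z d1; [right; right|left|right; left] => //.
    by rewrite dz.
  apply: (le_trans (muU_le _ _)); rewrite -[leRHS]adde0; apply: leeD => //.
  by apply: (le_trans (muU_le _ _)); rewrite Fd mu_set1 adde0.
have mid_le : \int[mu]_(t in `]c1, d1[) masked N.+1 t <= 0.
  (* Positive values occur only on [F] and outside the removed interval, hence only where the
     trimming has made [F] null, apart from the point [c0]. *)
  apply: int_le0; first exact: bmeas_masked.
  apply/eqP; rewrite eq_le; apply/andP; split; last exact: (outer_measure_ge0 (wlength (R:=R) idfun)^*%mu).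
  apply: (@le_trans _ _ (mu ((F `&` `]c1, c0[) `|` ([set c0] `|` (F `&` `]d0, d1[))))).
    apply: mu_mono => z [] /=; rewrite !in_itv/= => /andP[cz zd].
    case: ifPn; rewrite ?ltxx// => zI /masked_gt0 Fz.
    have [zc|cz0|->] := ltgtP z c0; [left|right; right|right; left] => //.
      by rewrite cz.
    split=> //; rewrite zd andbT ltNge; apply: contraNN zI => zd0.
    exact: Imid cz0 zd0 (lt_le_trans zd d1y).
  apply: (le_trans (muU_le _ _)); rewrite Fc add0e.
  by apply: (le_trans (muU_le _ _)); rewrite Fd mu_set1 adde0.
have c1y := le_trans cd1 d1y.
rewrite (int_split _ x c1 y (bmeas_masked _))// (int_split _ c1 d1 y (bmeas_masked _))//.
rewrite (int_split _ x c1 y bh)// (int_split _ c1 d1 y bh)//.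
by apply: lerD => //; apply: lerD => //; exact: le_trans mid_le mid.
Qed.

End induction.
End rising_sun.

(** * Exhausting a sublevel set by intervals *)

Section sublevel.
Context {R : realType}.
Notation T := (lebesgue_line R).
Notation mu := (@completed_lebesgue_measure R).

Lemma bmeasD (f g : R -> R) : bmeas f -> bmeas g -> bmeas (fun t => f t + g t).
Proof.
move=> [mf [M fM]] [mg [N gN]]; split; first exact: measurable_funD.
by exists (M + N) => x; rewrite (le_trans (ler_normD _ _))// lerD.
Qed.

Lemma bmeasM (f g : R -> R) : bmeas f -> bmeas g -> bmeas (fun t => f t * g t).
Proof.
move=> [mf [M fM]] [mg [N gN]]; split; first exact: measurable_funM.
by exists (M * N) => x; rewrite normrM ler_pM.
Qed.

Lemma intD (f g : R -> R) a b : bmeas f -> bmeas g ->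
  \int[mu]_(t in `]a, b[) (f t + g t) =
  \int[mu]_(t in `]a, b[) f t + \int[mu]_(t in `]a, b[) g t.
Proof.
move=> bf bg; apply: RintegralD; [exact: measurable_lline_itv|exact: bmeas_int..].
Qed.

Lemma intZl (k : R) (f : R -> R) a b : bmeas f ->
  \int[mu]_(t in `]a, b[) (k * f t) = k * \int[mu]_(t in `]a, b[) f t.
Proof.
by move=> bf; apply: RintegralZl; [exact: measurable_lline_itv|exact: bmeas_int].
Qed.

Lemma bmeas_indic (A : set R) (k : R) : measurable (A : set T) ->
  bmeas (fun t => if t \in A then k else 0).
Proof.
by move=> mA; apply: bmeas_if; [exact: measurable_pred|exact: bmeas_cst..].
Qed.

Lemma int_indic (A : set R) (k : R) a b : measurable (A : set T) ->
  \int[mu]_(t in `]a, b[) (if t \in A then k else 0) =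
  k * fine (mu (A `&` `]a, b[)).
Proof.
move=> mA; have -> : (fun t => if t \in A then k else 0) =
    (fun t => k * (if t \in A then 1 else 0)).
  by apply/funext => t; case: ifP; rewrite ?mulr1 ?mulr0.
rewrite intZl; last exact: bmeas_indic.
congr (_ * fine _); rewrite -integral_indic//; last exact: measurable_lline_itv.
by apply: eq_integral => t _; rewrite indicE; case: (t \in A).
Qed.

(** The outer measure is an infimum over countable covers by half-open intervals, which is why
    [masked] removes intervals of the form []c, d]]. *)
Lemma outer_cover (E : set R) (e : R) : (mu E < +oo)%E -> 0 < e ->
  exists c d : nat -> R, E `<=` \bigcup_i `]c i, d i]%classic /\
    (mu (\bigcup_i `]c i, d i]%classic) <= mu E + e%:E)%E.
Proof.
move=> Efin e0; have Enum : mu E \is a fin_num.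
  by rewrite ge0_fin_numE//; exact: (outer_measure_ge0 (wlength (R:=R) idfun)^*%mu).
have [_ /= [A [mA EA] <-] Ae] := lb_ereal_inf_adherent e0 Enum.
have /choice[p pA] : forall i, exists p : R * R, A i = `]p.1, p.2]%classic.
  move=> i; have /ocitvP[->|[p _ ->]] := mA i; last by exists p.
  by exists (0, 0); rewrite set_itv_ge// bnd_simp ltxx.
have UA : \bigcup_i `](p i).1, (p i).2]%classic = \bigcup_i A i.
  by apply: eq_bigcup => // i _; rewrite pA.
exists (fun i => (p i).1), (fun i => (p i).2); rewrite UA; split=> //.
apply: (@le_trans _ _ (\sum_(0 <= k <oo) wlength idfun (A k))%E); last exact: ltW.
apply: (le_trans (outer_measure_sigma_subadditive (wlength idfun)^*%mu A)).
by apply: lee_nneseries => // n _; rewrite -(measurable_mu_extE _ (mA n)).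
Qed.

Lemma fine_mu_le (A : set R) (e : R) : (mu A <= e%:E)%E -> fine (mu A) <= e.
Proof.
move=> Ae; rewrite -lee_fin fineK// ge0_fin_numE ?(le_lt_trans Ae) ?ltry//.
Qed.

Definition covered (c d : nat -> R) N := \bigcup_(i in `I_N) `]c i, d i]%classic.

Lemma masked_in (h : R -> R) F lam c d N t : t \in covered c d N ->
  masked h F lam c d N t = 0.
Proof.
rewrite inE => -[]; elim: N => [//|N IH] i /= iN tI.
case: ifPn => // tN; move: iN; rewrite ltnS leq_eqVlt => /predU1P[iN|iN].
  by rewrite -iN tI in tN.
exact: IH iN tI.
Qed.

Lemma masked_notin (h : R -> R) F lam c d N t : t \notin covered c d N ->
  masked h F lam c d N t = if t \in F then h t else - lam.
Proof.
rewrite notin_setE => tN; elim: N tN => [//|N IH] tN /=.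
case: ifPn => tI; first by exfalso; apply: tN; exists N => //=.
by apply: IH => -[i iN ti]; apply: tN; exists i => //; exact: ltnW.
Qed.

(** The conclusion says that [h] has nonnegative integral off [F], which is (1). It is the limit of
    [masked_le] along finer covers of []a, b[] minus [F]. *)
Lemma int_good_le (h : R -> R) (F : set R) (lam C a b : R) :
  bmeas h -> measurable (F : set T) -> 0 <= lam -> 0 < C ->
  (forall t, - lam <= h t) -> (forall t, h t <= C) ->
  (forall x y, a <= x -> x < y -> y <= b ->
     (0 < mu (F `&` `]x, y[))%E -> 0 <= \int[mu]_(t in `]x, y[) h t) ->
  a <= b -> 0 <= \int[mu]_(t in `]a, b[) h t ->
  \int[mu]_(t in `]a, b[) (if t \in F then h t else 0) <= \int[mu]_(t in `]a, b[) h t.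
Proof.
move=> bh mF lam0 C0 hlam hC goodF ab good.
suff small e : 0 < e -> \int[mu]_(t in `]a, b[) (if t \in F then h t else 0) <=
    \int[mu]_(t in `]a, b[) h t + (C + lam) * e.
  apply/ler_addgt0Pr => e e0; have Cl : 0 < C + lam by rewrite ltr_pwDl.
  by have := small (e / (C + lam)) (divr_gt0 e0 Cl); rewrite mulrC divfK// gt_eqF.
move=> e0; pose E := `]a, b[%classic `\` F.
have mE : measurable (E : set T) by apply: measurableD => //; exact: measurable_lline_itv.
have finE : (mu E < +oo)%E by apply: le_lt_trans (mu_oo_fin a b); apply: mu_mono => t [].
have [c [d [EU muU]]] := outer_cover _ _ finE e0.
set U := \bigcup_i _ in EU muU.
have mU : measurable (U : set T) by apply: bigcupT_measurable => i; exact: measurable_lline_itv.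
have mUn N : measurable (covered c d N : set T).
  by apply: bigcup_measurable => i _; exact: measurable_lline_itv.
have mUE : measurable (U `\` E : set T) by exact: measurableD.
have [N muN] : exists N, (mu (E `\` covered c d N) <= e%:E)%E.
  have cvg0 : (mu (E `\` covered c d n) @[n --> \oo] --> 0)%E.
    have -> : 0%E = mu (\bigcap_n (E `\` covered c d n)).
      rewrite (_ : \bigcap_n _ = set0) ?measure0//; apply/seteqP; split=> // t EnU.
      have [Et _] := EnU 0%N I; have [i _ ti] := EU _ Et.
      by have [_] := EnU i.+1 I; apply; exists i => /=.
    apply: nonincreasing_cvg_mu.
    - by apply: le_lt_trans finE; apply: mu_mono => t [].
    - by move=> i; exact: measurableD.
    - by apply: bigcapT_measurable => i; exact: measurableD.
    - move=> m n mn; apply/subsetPset; apply: setDS => t [i im ti].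
      by exists i => //=; exact: leq_trans im mn.
  have /cvg0[] : nbhs 0%E [set x : \bar R | (x < e%:E)%E].
    by apply: open_nbhs_nbhs; split; [exact: open_ereal_lt_ereal|rewrite /= lte_fin].
  by move=> N _ /(_ N (leqnn N)) /= /ltW; exists N.
have muUE : (mu (U `\` E) <= e%:E)%E.
  rewrite measureD//; last by apply: le_lt_trans muU _; rewrite lte_add_pinfty ?ltry.
  by rewrite setIC (setIidl EU) leeBlDl// ge0_fin_numE.
(* The two errors of the cover: [p1] repays the points of [F] removed by mistake, where [h <= C] is
   lost, and [p2] the points off [F] not yet covered, where the masked function is [- lam] instead
   of 0. *)
pose p1 t : R := if t \in U `\` E then C else 0.
pose p2 t : R := if t \in E `\` covered c d N then lam else 0.
have mEN : measurable (E `\` covered c d N : set T) by exact: measurableD.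
have bm := bmeas_masked h F lam c d bh mF N.
have bp1 : bmeas p1 by exact: bmeas_indic.
have bp2 : bmeas p2 by exact: bmeas_indic.
apply: (@le_trans _ _ (\int[mu]_(t in `]a, b[) (masked h F lam c d N t + (p1 t + p2 t)))).
  apply: int_le.
  - by apply: bmeas_if; [exact: measurable_pred|exact: bh|exact: bmeas_cst].
  - exact: bmeasD bm (bmeasD _ _ bp1 bp2).
  move=> t tab; have p10 : 0 <= p1 t by rewrite /p1; case: ifP => // _; exact: ltW.
  have p20 : 0 <= p2 t by rewrite /p2; case: ifP.
  have [tU|tU] := boolP (t \in covered c d N).
    rewrite masked_in// add0r; case: ifPn => tF; last exact: addr_ge0.
    apply: (@le_trans _ _ (p1 t)); last by rewrite lerDl.
    rewrite /p1 ifT ?hC//; apply/mem_set; split.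
      by move: tU => /set_mem[i _ ti]; exists i.
    by move=> [_]; apply; exact: set_mem.
  rewrite masked_notin//; case: ifPn => tF; first by rewrite lerDl addr_ge0.
  rewrite addrCA (_ : p2 t = lam) ?addNr ?addr0// /p2 ifT//.
  apply/mem_set; split; first by split=> // /mem_set; exact/negP.
  by move=> /mem_set; exact/negP.
rewrite (intD _ _ _ _ bm (bmeasD _ _ bp1 bp2)) (intD _ _ _ _ bp1 bp2) !int_indic//; apply: lerD.
  exact: (masked_le h F lam C a b c d).
rewrite mulrDl; apply: lerD; apply: ler_wpM2l => //; try exact: ltW.
  by apply: fine_mu_le; apply: le_trans muUE; apply: mu_mono => t [].
by apply: fine_mu_le; apply: le_trans muN; apply: mu_mono => t [].
Qed.
End sublevel.

(** * One step in a subdivision of the levels *)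

Section layer.
Variables (R : realFieldType) (delta : R) (A B : R -> R).

(* When [A' = g] and [B' = s g], this is the integral of [(delta u - s) g(s)]
   for [s] between [u] and [l], and [0] if [l <= u]. *)
Definition layer (u l : R) : R :=
  if u < l then delta * u * (A l - A u) - (B l - B u) else 0.

(** The integrand is frozen at the left end [l], at a cost of at most [(m - l) * (A m - A l)]. The
    bound on increments of [B] is the discrete form of B' = s A' with [A] nondecreasing. When [u]
    falls between [l] and [m], [1 <= delta] gives [l <= delta * u], and the same error term covers
    the partial step. *)
Lemma layer_step (u l m : R) : 1 <= delta -> 0 <= u -> l <= m ->
  A l <= A m -> (l <= u -> u <= m -> A l <= A u) -> (l <= u -> u <= m -> A u <= A m) ->
  B m - B l <= m * (A m - A l) ->
  (l <= u -> u <= m -> B m - B u <= m * (A m - A u)) ->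
  layer u l + ((A m - A l) * (if u < l then delta * u - l else 0) +
    (- ((m - l) * (A m - A l)))) <= layer u m.
Proof.
move=> d1 u0 lm Alm Alu Aum Blm Bum; rewrite /layer.
have [ul|lu] := ltP u l; first by rewrite (lt_le_trans ul lm); lra.
have [um|mu] := ltP u m; last first.
  by have := mulr_ge0 (_ : 0 <= m - l) (_ : 0 <= A m - A l); rewrite !subr_ge0 => /(_ lm Alm); lra.
have {}Alu := Alu lu (ltW um); have {}Aum := Aum lu (ltW um); have {}Bum := Bum lu (ltW um).
have du : l <= delta * u by apply: (le_trans lu); rewrite ler_peMl.
have := mulr_ge0 (_ : 0 <= delta * u - l) (_ : 0 <= A m - A u).
have := mulr_ge0 (_ : 0 <= m - l) (_ : 0 <= A u - A l).
rewrite !subr_ge0 => /(_ lm Alu) + /(_ du Aum); lra.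
Qed.
End layer.

(** * Integration over the levels *)

Section layer_cake.
Context {R : realType}.
Notation T := (lebesgue_line R).
Notation mu := (@completed_lebesgue_measure R).

Lemma int_affine (v : R -> R) (k l a b : R) : a <= b -> bmeas v ->
  \int[mu]_(t in `]a, b[) (k * v t + l) = k * \int[mu]_(t in `]a, b[) v t + l * (b - a).
Proof.
move=> ab bv; have bkv := bmeasM _ _ (bmeas_cst k) bv.
by rewrite (intD _ _ _ _ bkv (bmeas_cst l)) (intZl _ _ _ _ bv) (int_cst _ _ _ ab).
Qed.

Lemma measurable_lt (v : R -> R) (l : R) : bmeas v ->
  measurable_fun [set: T] ((fun t => v t < l) : T -> bool).
Proof.
move=> [mv _]; apply: measurable_fun_ltr => //; exact: measurable_cst.
Qed.

(** This is (1), with RH_oo written without division or essential supremum. Take for [F] the set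
    where [lam <= v]: if [delta] times the average over []x, y[] were below [lam], then [F] would
    lie there in the exceptional null set. *)
Lemma sublevel_int_ge0 (v : R -> R) (delta M a b lam : R) :
  bmeas v -> (forall t, 0 <= v t <= M) -> 0 <= M -> 1 <= delta -> a <= b ->
  (forall x y, a <= x -> x < y -> y <= b ->
    mu (`]x, y[%classic `&` [set t | delta * \int[mu]_(s in `]x, y[) v s < v t * (y - x)])
      = 0%E) ->
  0 <= lam -> lam * (b - a) <= delta * \int[mu]_(s in `]a, b[) v s ->
  0 <= \int[mu]_(t in `]a, b[) (if v t < lam then delta * v t - lam else 0).
Proof.
move=> bv vM M0 d1 ab vRH lam0 lamv.
have d0 : 0 <= delta by apply: le_trans d1.
pose h t := delta * v t + - lam.
have bh : bmeas h := bmeasD _ _ (bmeasM _ _ (bmeas_cst delta) bv) (bmeas_cst (- lam)).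
pose F := [set t | lam <= v t].
have mF : measurable (F : set T).
  rewrite (_ : F = v @^-1` `[lam, +oo[%classic); last first.
    by apply/seteqP; split=> t /=; rewrite in_itv/= andbT.
  by rewrite -[X in measurable X]setTI; apply: (bmeas_measurable v bv).
have hlam t : - lam <= h t by rewrite /h lerDr mulr_ge0//; case/andP: (vM t).
(* The summand 1 keeps the bound positive when [M] is 0. *)
have hC t : h t <= delta * M + 1.
  rewrite /h; apply: lerD; last by apply: le_trans ler01; rewrite oppr_le0.
  by apply: ler_wpM2l => //; case/andP: (vM t).
have C0 : 0 < delta * M + 1 by apply: ltr_wpDl => //; exact: mulr_ge0.
have goodF x y : a <= x -> x < y -> y <= b ->
    (0 < mu (F `&` `]x, y[))%E -> 0 <= \int[mu]_(t in `]x, y[) h t.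
  move=> ax xy yb; rewrite (int_affine _ _ _ _ _ (ltW xy) bv) mulNr subr_ge0.
  apply: contraTT; rewrite -ltNge -leNgt => vlam; rewrite -(vRH _ _ ax xy yb).
  apply: mu_mono => t [Ft tx]; split=> //=; apply: (lt_le_trans vlam).
  by rewrite ler_wpM2r// subr_ge0 ltW.
have good : 0 <= \int[mu]_(t in `]a, b[) h t.
  by rewrite (int_affine _ _ _ _ _ ab bv) mulNr subr_ge0.
have bF : bmeas (fun t => if t \in F then h t else 0).
  by apply: bmeas_if; [exact: measurable_pred|exact: bh|exact: bmeas_cst].
have bE : bmeas (fun t => if v t < lam then delta * v t - lam else 0).
  by apply: bmeas_if; [exact: measurable_lt|exact: bh|exact: bmeas_cst].
have := int_good_le _ _ _ _ _ _ bh mF lam0 C0 hlam hC goodF ab good.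
have hE : h = (fun t => (if t \in F then h t else 0) +
    (if v t < lam then delta * v t - lam else 0)).
  apply/funext => t; have -> : (t \in F) = ~~ (v t < lam).
    by rewrite -leNgt; apply/idP/idP => [/set_mem|?]; [exact|exact: mem_set].
  by case: (v t < lam); rewrite /= ?add0r ?addr0.
have -> : \int[mu]_(t in `]a, b[) h t = \int[mu]_(t in `]a, b[) (if t \in F then h t else 0) +
    \int[mu]_(t in `]a, b[) (if v t < lam then delta * v t - lam else 0).
  by rewrite {1}hE; exact: intD bF bE.
by rewrite lerDl.
Qed.
Section telescoping.
Variables (u : R -> R) (delta eps Lam a b : R) (A B : R -> R).
Hypotheses (bu : bmeas u) (bAu : bmeas (A \o u)) (bBu : bmeas (B \o u)).
Hypotheses (d1 : 1 <= delta) (ab : a <= b) (eps0 : 0 < eps) (epsLam : eps <= Lam).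
Hypothesis uP : forall t, eps <= u t <= Lam.
Hypothesis uE : forall l, eps <= l -> l <= Lam ->
  0 <= \int[mu]_(t in `]a, b[) (if u t < l then delta * u t - l else 0).
Hypothesis A_nd : forall l m, eps <= l -> l <= m -> m <= Lam -> A l <= A m.
Hypothesis AB : forall l m, eps <= l -> l <= m -> m <= Lam ->
  B m - B l <= m * (A m - A l).

Lemma bmeas_layer l : bmeas (fun t => layer R delta A B (u t) l).
Proof.
apply: bmeas_if; [exact: measurable_lt| |exact: bmeas_cst].
rewrite (_ : (fun t => _) = (fun t => (delta * u t) * (A l + (-1) * (A \o u) t) +
    ((-1) * B l + (B \o u) t))); last by apply/funext => t /=; ring.
apply: bmeasD.
  apply: bmeasM; first exact: bmeasM (bmeas_cst delta) bu.
  exact: bmeasD (bmeas_cst (A l)) (bmeasM _ _ (bmeas_cst (-1)) bAu).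
exact: bmeasD (bmeas_cst _) bBu.
Qed.

Lemma bmeas_excess l : bmeas (fun t => if u t < l then delta * u t - l else 0).
Proof.
apply: bmeas_if; [exact: measurable_lt| |exact: bmeas_cst].
exact: bmeasD (bmeasM _ _ (bmeas_cst delta) bu) (bmeas_cst (- l)).
Qed.

Lemma int_layer_step l m : eps <= l -> l <= m -> m <= Lam ->
  \int[mu]_(t in `]a, b[) layer R delta A B (u t) l - (m - l) * (A m - A l) * (b - a) <=
  \int[mu]_(t in `]a, b[) layer R delta A B (u t) m.
Proof.
move=> el lm mL; have bl := bmeas_layer l; have bs := bmeas_excess l.
have bks := bmeasM _ _ (bmeas_cst (A m - A l)) bs.
apply: (@le_trans _ _ (\int[mu]_(t in `]a, b[) (layer R delta A B (u t) l +
   ((A m - A l) * (if u t < l then delta * u t - l else 0) +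
   - ((m - l) * (A m - A l)))))).
  rewrite (intD _ _ _ _ bl (bmeasD _ _ bks (bmeas_cst _))) (intD _ _ _ _ bks (bmeas_cst _)).
  rewrite (intZl _ _ _ _ bs) (int_cst _ _ _ ab) lerD2l mulNr lerDr.
  by apply: mulr_ge0; [rewrite subr_ge0 A_nd|apply: uE => //; exact: le_trans mL].
apply: int_le; [exact: bmeasD bl (bmeasD _ _ bks (bmeas_cst _))|exact: bmeas_layer|].
move=> t _; have /andP[eu uL] := uP t.
apply: layer_step => //.
- by apply: le_trans eu; exact: ltW.
- exact: A_nd.
- by move=> lu um; apply: A_nd.
- by move=> lu um; apply: A_nd.
- exact: AB.
- by move=> lu um; apply: AB.
Qed.

(** Over n + 1 equal steps the errors telescope to [K / n.+1%:R], because the increments of [A] add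
    up to [A Lam - A eps]. No integration in the level variable takes place. *)
Lemma int_layer_ge0 :
  0 <= \int[mu]_(t in `]a, b[) (delta * u t * (A Lam - A (u t)) - (B Lam - B (u t))).
Proof.
have -> : (fun t => delta * u t * (A Lam - A (u t)) - (B Lam - B (u t))) =
    (fun t => layer R delta A B (u t) Lam).
  apply/funext => t; rewrite /layer; have /andP[_] := uP t.
  by rewrite le_eqVlt => /predU1P[->|->//]; rewrite ltxx !subrr mulr0 subr0.
set I := (X in 0 <= X).
pose K := (Lam - eps) * (A Lam - A eps) * (b - a).
have K0 : 0 <= K by rewrite !mulr_ge0 ?subr_ge0//; exact: A_nd.
have step n : - (K / n.+1%:R) <= I.
  pose s := (Lam - eps) / n.+1%:R; pose l i := eps + s * i%:R.
  have s0 : 0 <= s by rewrite divr_ge0 ?subr_ge0.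
  have lS i : l i.+1 = l i + s by rewrite /l -natr1; ring.
  have el i : eps <= l i by rewrite lerDl mulr_ge0.
  have lL : l n.+1 = Lam by rewrite /l divfK ?pnatr_eq0// subrKC.
  have lLi i : (i <= n.+1)%N -> l i <= Lam.
    by move=> i_n; rewrite -lL lerD2l ler_wpM2l// ler_nat.
  have tel i : (i <= n.+1)%N -> - (s * (A (l i) - A eps) * (b - a)) <=
      \int[mu]_(t in `]a, b[) layer R delta A B (u t) (l i).
    elim: i => [_|i IH i_n].
      (* At the lowest level every layer vanishes, since [eps <= u t]. *)
      have -> : l 0%N = eps by rewrite /l mulr0 addr0.
      rewrite subrr mulr0 mul0r oppr0; apply: Rintegral_ge0 => t _.
      by rewrite /layer ltNge; have /andP[-> _] := uP t.
    have lii : l i <= l i.+1 by rewrite lS lerDl.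
    apply: le_trans (int_layer_step _ _ (el i) lii (lLi _ i_n)).
    apply: (le_trans _ (lerB (IH (ltnW i_n)) (lexx _))).
    rewrite le_eqVlt; apply/orP; left; apply/eqP.
    by rewrite lS; ring.
  have := tel n.+1 (leqnn _); rewrite lL; apply: le_trans.
  by rewrite le_eqVlt; apply/orP; left; apply/eqP; rewrite /K /s; ring.
apply/ler_addgt0Pr => e e0; rewrite -lerBlDr sub0r.
have [n Kn] : exists n : nat, K / n.+1%:R <= e.
  exists (Num.truncn (K / e)).
  rewrite ler_pdivrMr// mulrC -ler_pdivrMr//.
  by rewrite ltW// truncnS_gt.
by apply: le_trans (step n); rewrite lerN2.
Qed.
End telescoping.
End layer_cake.

(** [X] and [Y] stand for the integrals of u and u^(-p), [D] for the length of the interval and [N]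
    for L^(-p). [X] has a negative coefficient, so its lower bound can be inserted before solving
    for [Y]. *)
Lemma power_layer_solve (R : realFieldType) (p delta L N D X Y : R) :
  0 < p -> 0 < delta -> 0 < L -> 0 < N -> 0 < p + 1 - delta * p ->
  L * D / delta <= X ->
  0 <= - (delta * (N / L) / (p + 1)) * X + (- (p^-1 - delta / (p + 1)) * Y + N / p * D) ->
  Y <= N * D / (p + 1 - delta * p).
Proof.
move=> p0 d0 L0 N0 pd LX H; rewrite ler_pdivlMr//.
have p10 : 0 < p + 1 by rewrite addr_gt0.
have h : N * D <= delta * (N / L) * X.
  have : delta * (N / L) * (L * D / delta) <= delta * (N / L) * X.
    by rewrite ler_wpM2l// ltW// !mulr_gt0// invr_gt0.
  by congr (_ <= _); field; rewrite !gt_eqF.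
have : 0 <= p * (p + 1) * (- (delta * (N / L) / (p + 1)) * X +
    (- (p^-1 - delta / (p + 1)) * Y + N / p * D)).
  by rewrite mulr_ge0// ltW// mulr_gt0.
have -> : p * (p + 1) * (- (delta * (N / L) / (p + 1)) * X +
    (- (p^-1 - delta / (p + 1)) * Y + N / p * D)) =
    - (p * (delta * (N / L) * X)) - (p + 1 - delta * p) * Y + (p + 1) * (N * D).
  by field; rewrite !gt_eqF.
have : p * (N * D) <= p * (delta * (N / L) * X) by rewrite ler_pM2l.
lra.
Qed.

(** The case p = 0; here [Y] stands for the integral of ln L - ln u. *)
Lemma ln_layer_solve (R : realFieldType) (delta L D X Y : R) :
  0 < delta -> 0 < L -> L * D / delta <= X ->
  0 <= - (delta / L) * X + (- Y + delta * D) -> Y <= (delta - 1) * D.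
Proof.
move=> d0 L0 LX H.
have : delta / L * (L * D / delta) <= delta / L * X by rewrite ler_pM2l// divr_gt0.
have -> : delta / L * (L * D / delta) = D by field; rewrite !gt_eqF.
lra.
Qed.

(** * Inequalities for powers and logarithms *)

Section power_inequalities.
Context {R : realType}.
Implicit Types (l m p s x : R).

(** Young's inequality for the product of x^p and 1, with conjugate exponents (p + 1)/p and p +
    1. *)
Lemma powR_young p x : 0 < p -> 1 <= x -> (p + 1) * x `^ p <= p * (x * x `^ p) + 1.
Proof.
move=> p0 x1; have x0 : 0 < x := lt_le_trans ltr01 x1.
have p10 : 0 < p + 1 by rewrite addr_gt0.
have q0 : 0 < (p + 1) / p by rewrite divr_gt0.
have pq : ((p + 1) / p)^-1 + (p + 1)^-1 = 1 by field; rewrite !gt_eqF.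
have := conjugate_powR (powR_ge0 x p) ler01 q0 p10 pq.
rewrite mulr1 powR1 -powRrM (_ : p * ((p + 1) / p) = 1 + p); last by field; rewrite gt_eqF.
rewrite powRD; last by rewrite (gt_eqF x0) implybT.
rewrite powRr1 ?(ltW x0)// => H.
rewrite -[leRHS](_ : (p + 1) * (x * x `^ p / ((p + 1) / p) + 1 / (p + 1)) = _).
  by rewrite ler_pM2l.
by field; rewrite !gt_eqF.
Qed.

Lemma powRN_ni p l m : 0 <= p -> 0 < l -> l <= m -> m `^ (- p) <= l `^ (- p).
Proof.
move=> p0 l0 lm; have m0 := lt_le_trans l0 lm; rewrite !powRN lef_pV2 ?posrE ?powR_gt0//.
by apply: ge0_ler_powR => //; rewrite nnegrE ltW.
Qed.

Lemma powRN1 p l : 0 < l -> l `^ (- (p + 1)) = l `^ (- p) / l.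
Proof.
by move=> l0; rewrite opprD powRD ?(gt_eqF l0) ?implybT// powR_inv1// ltW.
Qed.

(** The increment condition of [layer_step] for the primitives of s^(-p-2) and s^(-p-1). By
    homogeneity it reduces to [powR_young] at [m / l]. *)
Lemma powR_layer p l m : 0 < p -> 0 < l -> l <= m ->
  (- (m `^ (- p) / p)) - (- (l `^ (- p) / p)) <=
  m * ((- (m `^ (- (p + 1)) / (p + 1))) - (- (l `^ (- (p + 1)) / (p + 1)))).
Proof.
move=> p0 l0 lm; have m0 := lt_le_trans l0 lm.
rewrite !powRN1//; set L := l `^ (- p); set N := m `^ (- p).
have N0 : 0 < N by rewrite powR_gt0.
have x1 : 1 <= m / l by rewrite ler_pdivlMr// mul1r.
have := powR_young _ _ p0 x1.
have -> : (m / l) `^ p = L / N.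
  have lge0 := ltW l0; have mge0 := ltW m0; have lV0 : 0 <= l^-1 by rewrite invr_ge0.
  rewrite (powRM _ mge0 lV0) -(powR_inv1 lge0) -powRrM mulN1r.
  by rewrite /L /N !powRN invrK mulrC.
move=> H; have p10 : 0 < p + 1 by rewrite addr_gt0.
rewrite -subr_ge0.
have -> : m * (- (N / m / (p + 1)) - - (L / l / (p + 1))) - (- (N / p) - - (L / p)) =
  N / (p * (p + 1)) * (p * (m / l * (L / N)) + 1 - (p + 1) * (L / N)).
  by field; rewrite !gt_eqF.
by apply: mulr_ge0; [rewrite ltW// divr_gt0// mulr_gt0|rewrite subr_ge0].
Qed.

(** The same condition for p = 0: ln(1 + x) <= x at x = m/l - 1. *)
Lemma ln_layer l m : 0 < l -> l <= m -> ln m - ln l <= m * (- m `^ (- 1) - - l `^ (- 1)).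
Proof.
move=> l0 lm; have m0 := lt_le_trans l0 lm.
rewrite -ln_div ?posrE// (powR_inv1 (ltW m0)) (powR_inv1 (ltW l0)) opprK mulrDr mulrN.
rewrite divff ?gt_eqF//; have := @le_ln1Dx R (m / l - 1); rewrite subrKC => H.
by rewrite [leRHS]addrC; apply: H; rewrite ltrBrDr addNr divr_gt0.
Qed.

(** Identifies the limit +oo of the truncated powers at the zeros of the weight. *)
Lemma powRN_unbounded p (L k : R) : 0 < p -> 0 < L ->
  exists2 s, 0 < s <= L & k <= s `^ (- p).
Proof.
move=> p0 L0; pose K := Num.max k 1; have K0 : 0 < K by rewrite lt_max ltr01 orbT.
pose s := Num.min L (K `^ (- p^-1)).
have s0 : 0 < s by rewrite lt_min L0 powR_gt0.
exists s; first by rewrite s0 ge_min lexx.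
apply: (@le_trans _ _ ((K `^ (- p^-1)) `^ (- p))).
  by rewrite -powRrM mulrNN mulVf ?gt_eqF// powRr1 ?(ltW K0)// le_max lexx.
by apply: powRN_ni => //; [exact: ltW|rewrite ge_min lexx orbT].
Qed.

Lemma ln_unbounded (L k : R) : 0 < L -> exists2 s, 0 < s <= L & k <= ln L - ln s.
Proof.
move=> L0; pose K := Num.max k 0; have K0 : 0 <= K by rewrite le_max lexx orbT.
exists (L * expR (- K)).
  by rewrite mulr_gt0 ?expR_gt0//= ger_pMr// expR_le1 oppr_le0.
by rewrite lnM ?posrE ?expR_gt0// expRK opprD opprK addrA subrr add0r le_max lexx.
Qed.
End power_inequalities.

Lemma ler_norm_between (R : realFieldType) (x y z : R) : x <= y -> y <= z ->
  `|y| <= `|x| + `|z|.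
Proof.
move=> xy yz; have := ler_norm (- x); have := ler_norm z; rewrite normrN.
have := normr_ge0 x; have := normr_ge0 z.
by rewrite ler_norml => *; apply/andP; split; lra.
Qed.

(** * Bounds for a truncated weight *)

Section consequences.
Context {R : realType}.
Notation T := (lebesgue_line R).
Notation mu := (@completed_lebesgue_measure R).
Variables (v : R -> R) (delta M a b : R).
Hypotheses (bv : bmeas v) (vM : forall t, 0 <= v t <= M) (M0 : 0 <= M).
Hypotheses (d1 : 1 <= delta) (ab : a < b).
Hypothesis vRH : forall x y, a <= x -> x < y -> y <= b ->
  mu (`]x, y[%classic `&` [set t | delta * \int[mu]_(s in `]x, y[) v s < v t * (y - x)])
    = 0%E.
Let V := \int[mu]_(s in `]a, b[) v s.
Hypothesis V0 : 0 < V.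
Let Lam := delta * V / (b - a).

(* The bound from above only changes [v] on a null set, see [Lam_ae]. *)
Definition trunc (e t : R) := Num.min (delta * V / (b - a)) (Num.max e (v t)).

Lemma ba_gt0 : 0 < b - a. Proof. by rewrite subr_gt0. Qed.

Lemma delta_gt0 : 0 < delta. Proof. exact: lt_le_trans d1. Qed.

Lemma Lam_gt0 : 0 < Lam.
Proof. by rewrite /Lam divr_gt0 ?mulr_gt0 ?delta_gt0 ?ba_gt0. Qed.

Lemma truncP e t : e <= Lam -> e <= trunc e t <= Lam.
Proof. by move=> eL; rewrite /trunc le_min ge_min le_max !lexx eL. Qed.

Lemma bmeas_trunc e : 0 < e -> e <= Lam -> bmeas (trunc e).
Proof.
move=> e0 eL; split.
  apply: measurable_minr; first exact: measurable_cst.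
  apply: measurable_maxr; [exact: measurable_cst|exact: bmeas_measurable bv].
exists Lam => t; have /andP[et tL] := truncP e t eL.
by rewrite ger0_norm// (le_trans (ltW e0)).
Qed.

Lemma Lam_ae : mu (`]a, b[%classic `&` [set t | Lam < v t]) = 0%E.
Proof.
rewrite -(vRH _ _ (lexx a) ab (lexx b)); congr (mu (_ `&` _)).
by apply/seteqP; split=> t /=; rewrite /Lam ltr_pdivrMr// ba_gt0.
Qed.

(** [v] exceeds its truncation only where it exceeds [Lam], which is a null set. The truncation from
    below may increase the integral, but this direction is the one needed, as u enters with a
    negative coefficient. *)
Lemma int_trunc e : 0 < e -> e <= Lam -> V <= \int[mu]_(t in `]a, b[) trunc e t.
Proof.
move=> e0 eL; have bt := bmeas_trunc e e0 eL; rewrite -subr_le0.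
have bN := bmeasM _ _ (bmeas_cst (-1)) bt.
have -> : V - \int[mu]_(t in `]a, b[) trunc e t =
    \int[mu]_(t in `]a, b[) (v t + (-1) * trunc e t).
  by rewrite (intD _ _ _ _ bv bN) (intZl _ _ _ _ bt) mulN1r.
apply: int_le0; first exact: bmeasD bv bN.
apply/eqP; rewrite eq_le; apply/andP; split;
  last exact: (outer_measure_ge0 (wlength (R:=R) idfun)^*%mu).
rewrite -Lam_ae; apply: mu_mono => t [tab /=]; rewrite mulN1r subr_gt0 /trunc.
rewrite gt_min => /orP[//|]; rewrite gt_max => /andP[_]; by rewrite ltxx.
Qed.

(** For [e < l <= Lam], truncation leaves the sublevel set unchanged and only raises [v] on it, so
    (1) is inherited. For [l = e] the sublevel set is empty. *)
Lemma sublevel_trunc e l : 0 < e -> e <= Lam -> e <= l -> l <= Lam ->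
  0 <= \int[mu]_(t in `]a, b[) (if trunc e t < l then delta * trunc e t - l else 0).
Proof.
move=> e0 eL el lL; have bt := bmeas_trunc e e0 eL.
have [->|ne] := eqVneq l e.
  apply: Rintegral_ge0 => t _; case: ifP => //.
  by rewrite ltNge; have /andP[-> _] := truncP e t eL.
have {}el : e < l by rewrite lt_neqAle eq_sym ne.
have l0 : 0 <= l by rewrite (le_trans (ltW e0))// ltW.
have lV : l * (b - a) <= delta * V by rewrite -ler_pdivlMr ?ba_gt0.
apply: (le_trans (sublevel_int_ge0 _ _ _ _ _ _ bv vM M0 d1 (ltW ab) vRH l0 lV)).
apply: int_le; [exact: bmeas_excess|exact: bmeas_excess|move=> t _].
rewrite /trunc -/Lam gt_min [Lam < l]ltNge lL/= gt_max el/=; case: ifP => // vl.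
rewrite lerD2r ler_wpM2l ?(ltW delta_gt0)// le_min le_max lexx orbT andbT.
exact: ltW (lt_le_trans vl lL).
Qed.

Lemma bmeas_comp_trunc (A : R -> R) K e : 0 < e -> e <= Lam ->
  measurable_fun [set: R] A -> (forall s, e <= s -> s <= Lam -> `|A s| <= K) ->
  bmeas (A \o trunc e).
Proof.
move=> e0 eL mA AK; split.
  exact: measurableT_comp mA (bmeas_measurable _ (bmeas_trunc e e0 eL)).
by exists K => t /=; have /andP[? ?] := truncP e t eL; exact: AK.
Qed.

Lemma layer_trunc (A B : R -> R) e : 0 < e -> e <= Lam ->
  measurable_fun [set: R] A -> measurable_fun [set: R] B ->
  (forall l m, 0 < l -> l <= m -> A l <= A m) ->
  (forall l m, 0 < l -> l <= m -> B l <= B m) ->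
  (forall l m, 0 < l -> l <= m -> B m - B l <= m * (A m - A l)) ->
  0 <= \int[mu]_(t in `]a, b[) (delta * trunc e t * (A Lam - A (trunc e t)) -
                                (B Lam - B (trunc e t))).
Proof.
move=> e0 eL mA mB And Bnd AB.
have bnd (f : R -> R) : (forall l m, 0 < l -> l <= m -> f l <= f m) ->
    forall s, e <= s -> s <= Lam -> `|f s| <= `|f e| + `|f Lam|.
  move=> fnd s es sL; have s0 := lt_le_trans e0 es.
  exact: ler_norm_between (fnd _ _ e0 es) (fnd _ _ s0 sL).
apply: (int_layer_ge0 (trunc e) delta e Lam a b A B (bmeas_trunc e e0 eL)
  (bmeas_comp_trunc _ _ _ e0 eL mA (bnd _ And))
  (bmeas_comp_trunc _ _ _ e0 eL mB (bnd _ Bnd)) d1 (ltW ab) e0 eL).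
- by move=> t; exact: truncP.
- by move=> l el lL; exact: sublevel_trunc.
- by move=> l m el lm _; apply: And lm; exact: lt_le_trans el.
- by move=> l m el lm _; apply: AB lm; exact: lt_le_trans el.
Qed.

(** Monotone convergence along [e n = Lam / n.+1%:R]. Where [v] is positive the integrand is
    eventually constant; where [v] vanishes it is [phi (e n)], which exceeds every [k]. *)
Lemma int_trunc_limit (phi : R -> R) K :
  measurable_fun [set: R] phi ->
  (forall l m, 0 < l -> l <= m -> m <= Lam -> phi m <= phi l) -> 0 <= phi Lam ->
  (forall k, exists2 s, 0 < s <= Lam & k <= phi s) ->
  (forall e, 0 < e -> e <= Lam -> \int[mu]_(t in `]a, b[) phi (trunc e t) <= K) ->
  (\int[mu]_(t in `]a, b[)
     (if v t == 0%R then +oo else (phi (Num.min Lam (v t)))%:E) <= K%:E)%E.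
Proof.
move=> mphi phi_ni phiL phi_oo phiK.
pose e n : R := Lam / n.+1%:R.
have e0 n : 0 < e n by rewrite divr_gt0 ?Lam_gt0.
have eL n : e n <= Lam.
  by rewrite ler_pdivrMr// ler_peMr ?ler1n// ltW// Lam_gt0.
have e_ni m n : (m <= n)%N -> e n <= e m.
  move=> mn; rewrite ler_pM2l ?Lam_gt0// lef_pV2 ?posrE ?ltr0n//.
  by rewrite ler_nat ltnS.
have ttr n t : 0 < trunc (e n) t by apply: lt_le_trans (e0 n) _; case/andP: (truncP _ t (eL n)).
have f_bd n : bmeas (phi \o trunc (e n)).
  apply: (bmeas_comp_trunc phi (phi (e n)) (e n) (e0 n) (eL n) mphi) => s es sL.
  rewrite ger0_norm; first exact: phi_ni.
  by apply: (le_trans phiL); apply: phi_ni => //; exact: lt_le_trans es.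
pose f n t := (phi (trunc (e n) t))%:E.
have f0 n t : (0 <= f n t)%E.
  rewrite lee_fin (le_trans phiL)//; apply: phi_ni => //.
  by case/andP: (truncP _ t (eL n)).
have f_nd t m n : (m <= n)%N -> (f m t <= f n t)%E.
  move=> mn; rewrite lee_fin; apply: phi_ni => //; last by case/andP: (truncP _ t (eL m)).
  by rewrite /trunc le_min2// le_max2// e_ni.
have mab := measurable_lline_itv `]a, b[.
have fE n : (\int[mu]_(t in `]a, b[) f n t <= K%:E)%E.
  rewrite -[leLHS]fineK; first by rewrite lee_fin; exact: phiK.
  by apply: integrable_fin_num => //; exact: bmeas_int (f_bd n).
have cvgf := @cvg_monotone_convergence _ _ _ mu _ mab f.
have {}cvgf := cvgf (fun n => measurable_funTS (proj2 (measurable_EFinP _ _) (bmeas_measurable _ (f_bd n)))) (fun n t _ => f0 n t) (fun t _ m n => f_nd t m n).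
rewrite (_ : \int[mu]_(t in _) _ = \int[mu]_(t in `]a, b[) limn (f^~ t))%E.
  rewrite -(cvg_lim _ cvgf)//; apply: lime_le; first by apply/cvgP: cvgf.
  by near=> n; exact: fE.
apply: eq_integral => t _; apply/esym.
have cf : cvgn (f^~ t) by apply: ereal_nondecreasing_is_cvgn => m n; exact: f_nd.
have e_near s : 0 < s -> \forall n \near \oo, e n <= s.
  move=> s0; have sL : 0 < s / Lam by rewrite divr_gt0// Lam_gt0.
  have := near_infty_natSinv_lt (PosNum sL); apply: filterS => n /= /ltW.
  by rewrite ler_pdivlMr ?Lam_gt0// mulrC.
have [vt|vt] := eqVneq (v t) 0.
  apply/eqyP => k k0; have [s /andP[s0 sL] ks] := phi_oo k.
  apply: lime_ge => //; have := e_near s s0; apply: filterS => n es.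
  rewrite lee_fin (le_trans ks)// /trunc vt (max_l (ltW (e0 n))) (min_r (eL n)).
  exact: phi_ni.
have v0 : 0 < v t by rewrite lt_neqAle eq_sym vt; case/andP: (vM t).
apply/cvg_lim => //; apply: cvg_near_cst; have := e_near _ v0; apply: filterS => n ev.
by rewrite /f /trunc (max_r ev).
Unshelve. all: by end_near. Qed.
Lemma int_trunc_Lam e : 0 < e -> e <= Lam ->
  Lam * (b - a) / delta <= \int[mu]_(t in `]a, b[) trunc e t.
Proof.
move=> e0 eL; rewrite /Lam divfK ?gt_eqF ?ba_gt0// mulrAC divff ?gt_eqF ?delta_gt0// mul1r.
exact: int_trunc.
Qed.

Lemma bmeas_phi_trunc (phi : R -> R) e : 0 < e -> e <= Lam ->
  measurable_fun [set: R] phi ->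
  (forall l m, 0 < l -> l <= m -> phi m <= phi l) -> bmeas (phi \o trunc e).
Proof.
move=> e0 eL mphi ni.
apply: (bmeas_comp_trunc phi (`|phi Lam| + `|phi e|) e e0 eL mphi).
move=> s es sL; have s0 := lt_le_trans e0 es.
exact: ler_norm_between (ni _ _ s0 sL) (ni _ _ e0 es).
Qed.

(** Integration of (1) against l^(-p-2): the two functions passed to [layer_trunc] are primitives of
    s^(-p-2) and s^(-p-1). *)
Lemma int_power_trunc p e : 0 < p -> 0 < p + 1 - delta * p -> 0 < e -> e <= Lam ->
  \int[mu]_(t in `]a, b[) trunc e t `^ (- p) <=
  Lam `^ (- p) * (b - a) / (p + 1 - delta * p).
Proof.
move=> p0 pd e0 eL; have p10 : 0 < p + 1 by rewrite addr_gt0.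
have mA : measurable_fun [set: R] (fun s : R => - (s `^ (- (p + 1)) / (p + 1))).
  apply: measurable_funN; apply: measurable_funM; [exact: measurable_powR|exact: measurable_cst].
have mB : measurable_fun [set: R] (fun s : R => - (s `^ (- p) / p)).
  apply: measurable_funN; apply: measurable_funM; [exact: measurable_powR|exact: measurable_cst].
have And l m : 0 < l -> l <= m -> - (l `^ (- (p + 1)) / (p + 1)) <= - (m `^ (- (p + 1)) / (p + 1)).
  move=> l0 lm; rewrite lerN2 ler_pM2r ?invr_gt0//; apply: powRN_ni => //; exact: ltW.
have Bnd l m : 0 < l -> l <= m -> - (l `^ (- p) / p) <= - (m `^ (- p) / p).
  move=> l0 lm; rewrite lerN2 ler_pM2r ?invr_gt0//; apply: powRN_ni => //; exact: ltW.
have := layer_trunc _ _ e e0 eL mA mB And Bnd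
  (fun l m l0 lm => powR_layer p l m p0 l0 lm).
have bt := bmeas_trunc e e0 eL.
have bp : bmeas (fun t => trunc e t `^ (- p)).
  apply: (bmeas_phi_trunc _ e e0 eL (@measurable_powR _ (- p))) => l m l0 lm.
  by apply: powRN_ni => //; exact: ltW.
(* [c2], [c3] and [c1] are the coefficients of u, u^(-p) and 1 in the integrand of [layer_trunc], u
   being the truncation. Both [c2] and [c3] are negative, the latter by [pd]. *)
set c2 := - (delta * (Lam `^ (- p) / Lam) / (p + 1)).
set c3 := - (p^-1 - delta / (p + 1)).
set c1 := Lam `^ (- p) / p.
have -> : (fun t => delta * trunc e t * (- (Lam `^ (- (p + 1)) / (p + 1)) -
      - (trunc e t `^ (- (p + 1)) / (p + 1))) -
      (- (Lam `^ (- p) / p) - - (trunc e t `^ (- p) / p))) =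
    (fun t => c2 * trunc e t + (c3 * (trunc e t `^ (- p)) + c1)).
  apply/funext => t; have /andP[et _] := truncP e t eL.
  have t0 := lt_le_trans e0 et.
  rewrite (powRN1 p _ Lam_gt0) (powRN1 p _ t0) /c1 /c2 /c3; field.
  have L0 := Lam_gt0; by rewrite !gt_eqF.
have b2 := bmeasM _ _ (bmeas_cst c2) bt; have b3 := bmeasM _ _ (bmeas_cst c3) bp.
rewrite (intD _ _ _ _ b2 (bmeasD _ _ b3 (bmeas_cst c1))) (intZl _ _ _ _ bt).
rewrite (intD _ _ _ _ b3 (bmeas_cst c1)) (intZl _ _ _ _ bp) (int_cst _ _ _ (ltW ab)).
move: (int_trunc_Lam e e0 eL).
move: (\int[mu]_(t in `]a, b[) trunc e t) (\int[mu]_(t in `]a, b[) trunc e t `^ (- p)) => X Y.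
exact: power_layer_solve p0 delta_gt0 Lam_gt0 (powR_gt0 _ Lam_gt0) pd.
Qed.

Lemma int_ln_trunc e : 0 < e -> e <= Lam ->
  \int[mu]_(t in `]a, b[) (ln Lam - ln (trunc e t)) <= (delta - 1) * (b - a).
Proof.
move=> e0 eL.
have mA : measurable_fun [set: R] (fun s : R => - s `^ (- 1)).
  by apply: measurable_funN; exact: measurable_powR.
have And (l m : R) : 0 < l -> l <= m -> - l `^ (- 1) <= - m `^ (- 1).
  by move=> l0 lm; rewrite lerN2; exact: powRN_ni.
have ln_nd (l m : R) : 0 < l -> l <= m -> ln l <= ln m.
  by move=> l0 lm; rewrite ler_ln ?posrE// (lt_le_trans l0).
have := layer_trunc _ _ e e0 eL mA (@measurable_ln R) And ln_nd ln_layer.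
have bt := bmeas_trunc e e0 eL.
have mphi : measurable_fun [set: R] (fun s : R => ln Lam - ln s).
  by apply: measurable_funB; [exact: measurable_cst|exact: measurable_ln].
have bp : bmeas (fun t => ln Lam - ln (trunc e t)).
  apply: (bmeas_phi_trunc _ e e0 eL mphi) => l m l0 lm.
  by rewrite lerB// ln_nd.
have -> : (fun t => delta * trunc e t * (- Lam `^ (- 1) - - trunc e t `^ (- 1)) -
      (ln Lam - ln (trunc e t))) =
    (fun t => - (delta / Lam) * trunc e t + ((-1) * (ln Lam - ln (trunc e t)) + delta)).
  apply/funext => t; have /andP[et _] := truncP e t eL.
  have t0 := lt_le_trans e0 et; have L0 := Lam_gt0.
  rewrite (powR_inv1 (ltW t0)) (powR_inv1 (ltW L0)); field.
  by rewrite !gt_eqF.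
have b2 := bmeasM _ _ (bmeas_cst (- (delta / Lam))) bt.
have b3 := bmeasM _ _ (bmeas_cst (-1)) bp.
rewrite (intD _ _ _ _ b2 (bmeasD _ _ b3 (bmeas_cst delta))) (intZl _ _ _ _ bt).
rewrite (intD _ _ _ _ b3 (bmeas_cst delta)) (intZl _ _ _ _ bp) (int_cst _ _ _ (ltW ab)).
rewrite mulN1r; apply: ln_layer_solve; [exact: delta_gt0|exact: Lam_gt0|].
exact: int_trunc_Lam.
Qed.

Lemma int_power_bound p : 0 < p -> 0 < p + 1 - delta * p ->
  (\int[mu]_(t in `]a, b[)
     (if v t == 0%R then +oo else (Num.min Lam (v t) `^ (- p))%:E) <=
   (Lam `^ (- p) * (b - a) / (p + 1 - delta * p))%:E)%E.
Proof.
move=> p0 pd; apply: (int_trunc_limit (fun s => s `^ (- p))).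
- exact: measurable_powR.
- by move=> l m l0 lm _; apply: powRN_ni => //; exact: ltW.
- exact: powR_ge0.
- by move=> k; apply: powRN_unbounded => //; exact: Lam_gt0.
- by move=> e e0 eL; exact: int_power_trunc.
Qed.

Lemma int_ln_bound :
  (\int[mu]_(t in `]a, b[)
     (if v t == 0%R then +oo else (ln Lam - ln (Num.min Lam (v t)))%:E) <=
   ((delta - 1) * (b - a))%:E)%E.
Proof.
apply: (int_trunc_limit (fun s => ln Lam - ln s)).
- by apply: measurable_funB; [exact: measurable_cst|exact: measurable_ln].
- by move=> l m l0 lm _; rewrite lerB// ler_ln ?posrE// (lt_le_trans l0).
- by rewrite subrr.
- by move=> k; apply: ln_unbounded; exact: Lam_gt0.
- by move=> e e0 eL; exact: int_ln_trunc.
Qed.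

End consequences.

(** * Weights of class RH_oo *)

Section averages.
Context {R : realType}.
Notation T := (lebesgue_line R).
Notation mu := (@completed_lebesgue_measure R).

Definition between (a b : R) (J : set R) : Prop :=
  `]a, b[ `<=` J /\ J `<=` `[a, b].

Lemma bounded_interval_between (J : set R) : bounded_interval J ->
  exists a b, a < b /\ between a b J.
Proof.
move=> [itvJ [M [_ JM]] [x [y [Jx Jy xy]]]].
have {}JM t : J t -> `|t| <= M + 1 by apply: JM; rewrite ltrDl.
have infJ : has_inf J.
  split; [by exists x|exists (- (M + 1)) => t /JM]; by rewrite ler_norml => /andP[].
have supJ : has_sup J.
  split; [by exists x|exists (M + 1) => t /JM]; by rewrite ler_norml => /andP[].
have infle t : J t -> inf J <= t by apply: ge_inf; case: infJ.
have lesup t : J t -> t <= sup J by apply: ub_le_sup; case: supJ.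
exists (inf J), (sup J); split; first exact: le_lt_trans (infle _ Jx) (lt_le_trans xy (lesup _ Jy)).
split=> t /=; rewrite in_itv/=; last by move=> Jt; rewrite infle ?lesup.
move=> /andP[it ts].
have [s Js st] := inf_lt infJ.1 it; have [r Jr tr] := sup_gt supJ.1 ts.
by apply: (itvJ _ _ Js Jr); rewrite !ltW.
Qed.

Lemma measurable_bounded_interval (J : set R) : bounded_interval J -> measurable (J : set T).
Proof. by move=> [itvJ _ _]; apply: lebesgue_line_borel; exact: is_interval_measurable. Qed.

Lemma mu_between (J : set R) a b : a < b -> between a b J -> mu J = (b - a)%:E.
Proof.
move=> ab [abJ Jab]; apply/eqP; rewrite eq_le; apply/andP; split.
  apply: (le_trans (mu_mono _ _ Jab)).
  by rewrite completed_borel lebesgue_measure_itv/= lte_fin ab.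
by rewrite -(mu_oo _ _ (ltW ab)); exact: mu_mono.
Qed.

(** Once both integrands are extended by 0 to the line, they differ only on the given null set and
    possibly at the two endpoints. *)
Lemma integral_between (J : set R) a b (f g : R -> \bar R) : a < b -> between a b J ->
  measurable (J : set T) ->
  measurable_fun (J : set T) (f : T -> \bar R) ->
  measurable_fun (`]a, b[ : set T) (g : T -> \bar R) ->
  mu.-negligible (`]a, b[ `&` [set t | f t <> g t]) ->
  (\int[mu]_(t in J) f t = \int[mu]_(t in `]a, b[) g t)%E.
Proof.
move=> ab [abJ Jab] mJ mf mg fg; rewrite integral_mkcond [RHS]integral_mkcond.
have mab := measurable_lline_itv `]a, b[.
apply: ae_eq_integral; first exact: measurableT.
- by apply/(measurable_restrictT _ mJ).
- by apply/(measurable_restrictT _ mab).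
have neg1 c : mu.-negligible [set c].
  apply/negligibleP; last exact: mu_set1.
  by apply: lebesgue_line_borel; exact: measurable_set1.
apply: negligibleS (negligibleU fg (negligibleU (neg1 a) (neg1 b))) => t /=.
move/not_implyP => [_]; rewrite /patch.
have [tab|tab] := boolP (t \in `]a, b[%classic).
  by rewrite (mem_set (abJ _ (set_mem tab))) => ?; left; split=> //; exact: set_mem.
case: ifPn => // /set_mem Jt _; right.
have /andP[at_ tb] : a <= t <= b by have := Jab _ Jt; rewrite /= in_itv.
have [ta|ta] := eqVneq t a; [by left|right].
apply/eqP; apply: contraNT tab => ntb; apply/mem_set; rewrite /= in_itv/=.
by rewrite !lt_neqAle eq_sym ta at_ ntb tb.
Qed.

Lemma avg_between (J : set R) a b (f g : R -> \bar R) : a < b -> between a b J ->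
  measurable (J : set T) ->
  measurable_fun (J : set T) (f : T -> \bar R) ->
  measurable_fun (`]a, b[ : set T) (g : T -> \bar R) ->
  mu.-negligible (`]a, b[ `&` [set t | f t <> g t]) ->
  avg J f = ((b - a)^-1%:E * \int[mu]_(t in `]a, b[) g t)%E.
Proof.
move=> ab bJ mJ mf mg fg; rewrite /avg (mu_between _ _ _ ab bJ) inver.
by rewrite gt_eqF ?subr_gt0// (integral_between J a b f g).
Qed.
Lemma negligible_mu0 (N : set R) : mu.-negligible (N : set T) -> mu N = 0%E.
Proof.
move=> [A [_ A0 NA]]; apply/eqP; rewrite eq_le; apply/andP; split.
  by rewrite -A0; exact: mu_mono.
exact: (outer_measure_ge0 (wlength (R:=R) idfun)^*%mu).
Qed.

Lemma bounded_interval_oo (x y : R) : x < y -> bounded_interval (`]x, y[%classic : set R).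
Proof.
move=> xy; split; first exact: interval_is_interval.
  exists (`|x| + `|y|); split; first exact: num_real.
  move=> M xyM t /=; rewrite in_itv/= => /andP[xt ty]; apply: le_trans (ltW xyM).
  exact: ler_norm_between (ltW xt) (ltW ty).
exists (x + (y - x) / 3), (x + (y - x) / 2); rewrite /= !in_itv/=.
by split; [apply/andP; split|apply/andP; split|]; lra.
Qed.

Lemma ess_sup_on_le (J : set R) (w : R -> R) (m : R) :
  (ess_sup_on J (EFin \o w) <= m%:E)%E -> mu.-negligible (J `&` [set t | m < w t]).
Proof.
move=> /ess_supP; apply: negligibleS => t /= [Jt mw]; rewrite /patch mem_set// lee_fin.
by apply/negP; rewrite -ltNge.
Qed.

(** RH_oo on [I] itself bounds [w] almost everywhere by [delta] times its average. Capping [w] there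
    and extending it by 0 gives a function bounded on the whole line, to which the previous parts
    apply; averages and exceptional null sets carry over. *)
Lemma RHinfty_model (I : set R) (delta : R) (w : R -> R) :
  bounded_interval I -> 1 <= delta -> RHinfty I delta w ->
  exists v M, [/\ bmeas v, (forall t, 0 <= v t <= M), 0 <= M,
    mu.-negligible (I `&` [set t | w t <> v t]) &
    forall x y, x < y -> `]x, y[ `<=` I ->
      0 < \int[mu]_(t in `]x, y[) v t /\
      mu (`]x, y[%classic `&`
        [set t | delta * \int[mu]_(s in `]x, y[) v s < v t * (y - x)]) = 0%E].
Proof.
move=> HI d1 [[mw w0] RH]; have d0 : 0 < delta := lt_le_trans ltr01 d1.
have ess J : subinterval I J -> (ess_sup_on J (EFin \o w) <=
    (delta * fine (avg J (EFin \o w)))%:E)%E.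
  move=> IJ; have [/andP[a0 aoo]] := RH J IJ.
  have afin : avg J (EFin \o w) \is a fin_num by rewrite ge0_fin_numE// ltW.
  rewrite -(fineK afin) inver gt_eqF; last by rewrite fine_gt0// a0.
  by rewrite lee_pdivrMr ?EFinM// fine_gt0// a0.
have mI := measurable_bounded_interval I HI.
have II : subinterval I I by split.
pose M := delta * fine (avg I (EFin \o w)).
have M0 : 0 <= M.
  by rewrite mulr_ge0 ?(ltW d0)// fine_ge0//; have [/andP[/ltW]] := RH I II.
pose v t := Num.min M (if t \in I then w t else 0).
have vM t : 0 <= v t <= M.
  rewrite /v le_min ge_min M0 lexx/= andbT; case: ifPn => // /set_mem; exact: w0.
have bv : bmeas v.
  split; last by exists M => t; have /andP[? ?] := vM t; rewrite ger0_norm.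
  apply: measurable_minr; first exact: measurable_cst.
  by have /(measurable_restrictT _ mI) := mw.
have vw : mu.-negligible (I `&` [set t | w t <> v t]).
  apply: negligibleS (ess_sup_on_le _ _ _ (ess I II)) => t /= [It wv]; split=> //.
  by rewrite ltNge; apply/negP => wM; apply: wv; rewrite /v mem_set// min_r.
exists v, M; split=> // x y xy xyI.
have Jxy := bounded_interval_oo x y xy; have Ixy : subinterval I `]x, y[%classic by split.
have avgE : avg `]x, y[%classic (EFin \o w) =
    ((y - x)^-1 * \int[mu]_(t in `]x, y[) v t)%:E.
  rewrite (avg_between _ x y _ (EFin \o v) xy).
  - by rewrite EFinM fineK//; apply: integrable_fin_num (bmeas_int _ _ _ bv); exact: measurable_lline_itv.
  - by split=> //; exact: subset_itv_oo_cc.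
  - exact: measurable_lline_itv.
  - by apply/measurable_EFinP; exact: measurable_funS mI xyI mw.
  - by apply/measurable_EFinP; apply: measurable_funTS; exact: bmeas_measurable.
  - by apply: negligibleS vw => t /= [xyt wv]; split; [exact: xyI|move=> E; apply: wv; rewrite E].
have yx : 0 < y - x by rewrite subr_gt0.
have [/andP[+ _] _] := RH _ Ixy; rewrite avgE lte_fin pmulr_rgt0 ?invr_gt0// => V0.
split=> //; apply: negligible_mu0; apply: negligibleS (ess_sup_on_le _ _ _ (ess _ Ixy)).
move=> t /= [txy Vt]; split=> //; rewrite avgE/= mulrCA mulrC ltr_pdivrMr//.
apply: (lt_le_trans Vt); rewrite ler_pM2r// /v mem_set; last exact: xyI.
by rewrite ge_min lexx orbT.
Qed.
End averages.

Lemma conj_exp1B (R : realType) (q : R) : 1 < q -> 1 - conj_exp q = - (q - 1)^-1.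
Proof. by move=> q1; rewrite /conj_exp; field; rewrite subr_eq0 gt_eqF. Qed.

(** With p = 1/(q-1), raising L^(-p) to the power q - 1 returns 1/L = D/(delta V), which cancels the
    average V/D and leaves 1/delta. *)
Lemma powR_const (R : realType) (q delta V D : R) : 1 < q -> 0 < delta -> delta < q ->
  0 < V -> 0 < D ->
  D^-1 * V * ((delta * V / D) `^ (- (q - 1)^-1) /
    ((q - 1)^-1 + 1 - delta * (q - 1)^-1)) `^ (q - 1) =
  delta^-1 * ((q - 1) / (q - delta)) `^ (q - 1).
Proof.
move=> q1 d0 dq V0 D0; have qp : 0 < q - 1 by rewrite subr_gt0.
have qd : 0 < q - delta by rewrite subr_gt0.
have -> : (q - 1)^-1 + 1 - delta * (q - 1)^-1 = ((q - 1) / (q - delta))^-1.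
  by field; rewrite !gt_eqF.
have L0 : 0 < delta * V / D by rewrite divr_gt0// mulr_gt0.
have c0 : 0 <= (q - 1) / (q - delta) by rewrite ltW// divr_gt0.
rewrite invrK (powRM _ (powR_ge0 _ _) c0) -powRrM mulNr mulVf ?gt_eqF//.
rewrite (powR_inv1 (ltW L0)) mulrA; congr (_ * _).
by field; rewrite !gt_eqF.
Qed.

(** * Upper bounds on a subinterval *)

Section upper_bound.
Context {R : realType}.
Notation T := (lebesgue_line R).
Notation mu := (@completed_lebesgue_measure R).

Lemma measurable_wpow (r : R) : measurable_fun [set: R] (fun a : R => wpow a r).
Proof.
rewrite /wpow; case: (r < 0); last first.
  under eq_fun do rewrite andbF.
  by apply/measurable_EFinP; exact: measurable_powR.
under eq_fun do rewrite andbT.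
apply: measurable_fun_ifT.
- by apply: measurable_fun_eqr; [exact: measurable_id|exact: measurable_cst].
- exact: measurable_cst.
- by apply/measurable_EFinP; exact: measurable_powR.
Qed.

Lemma measurable_lne_EFin : measurable_fun [set: R] (fun a : R => lne a%:E).
Proof.
apply: (measurable_fun_ifT (f := fun a : R => a <= 0)).
- by apply: measurable_fun_ler; [exact: measurable_id|exact: measurable_cst].
- exact: measurable_cst.
- by apply/measurable_EFinP; exact: measurable_ln.
Qed.

Variables (I : set R) (delta : R) (w : R -> R) (J : set R).
Hypotheses (HI : bounded_interval I) (d1 : 1 <= delta) (RH : RHinfty I delta w).
Hypothesis (IJ : subinterval I J).

Lemma RHinfty_local : exists v M a b,
  [/\ bmeas v, (forall t, 0 <= v t <= M), 0 <= M, a < b & 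
   [/\ between a b J,
    mu.-negligible (`]a, b[ `&` [set t | w t <> v t]),
    0 < \int[mu]_(t in `]a, b[) v t &
    forall x y, a <= x -> x < y -> y <= b ->
      mu (`]x, y[%classic `&`
        [set t | delta * \int[mu]_(s in `]x, y[) v s < v t * (y - x)]) = 0%E]].
Proof.
have [v [M [bv vM M0 vw vRH]]] := RHinfty_model I delta w HI d1 RH.
have [a [b [ab bJ]]] := bounded_interval_between _ IJ.1.
have abI : `]a, b[ `<=` I by move=> t /bJ.1; exact: IJ.2.
exists v, M, a, b; split=> //; split=> //.
- by apply: negligibleS vw => t [/abI].
- by have [] := vRH _ _ ab abI.
- move=> x y ax xy yb; have [|//] := vRH x y xy.
  by move=> t /= /[!in_itv]/= /andP[xt ty]; apply: abI; rewrite /= in_itv/= (le_lt_trans ax xt) (lt_le_trans ty).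
Qed.

Let mJ : measurable (J : set T) := measurable_bounded_interval _ IJ.1.

Let mwJ : measurable_fun (J : set T) (w : T -> R).
Proof. exact: measurable_funS (measurable_bounded_interval _ HI) IJ.2 RH.1.1. Qed.

Lemma avg_model v a b : bmeas v -> a < b -> between a b J ->
  mu.-negligible (`]a, b[ `&` [set t | w t <> v t]) ->
  avg J (EFin \o w) = ((b - a)^-1 * \int[mu]_(t in `]a, b[) v t)%:E.
Proof.
move=> bv ab bJ wv; rewrite (avg_between J a b _ (EFin \o v) ab bJ mJ).
- by rewrite EFinM fineK//; apply: integrable_fin_num (bmeas_int _ _ _ bv); exact: measurable_lline_itv.
- by apply/measurable_EFinP.
- by apply/measurable_EFinP; apply: measurable_funTS; exact: bmeas_measurable.
- by apply: negligibleS wv => t /= [xyt wv]; split=> // E; apply: wv; rewrite E.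
Qed.

Lemma negligible_Lam v a b : bmeas v -> a < b ->
  (forall x y, a <= x -> x < y -> y <= b ->
      mu (`]x, y[%classic `&`
        [set t | delta * \int[mu]_(s in `]x, y[) v s < v t * (y - x)]) = 0%E) ->
  mu.-negligible (`]a, b[ `&`
    [set t | delta * (\int[mu]_(s in `]a, b[) v s) / (b - a) < v t]).
Proof.
move=> bv ab vRH; apply/negligibleP; last exact: (Lam_ae v delta a b ab vRH).
apply: measurableI; first exact: measurable_lline_itv.
set L := _ / _; rewrite (_ : [set t | _] = v @^-1` `]L, +oo[%classic); last first.
  by apply/seteqP; split=> t /=; rewrite in_itv/= andbT.
by rewrite -[X in measurable X]setTI; apply: (bmeas_measurable v bv).
Qed.

Lemma Aq_le q : 1 < q -> delta < q ->
  (avg J (EFin \o w) * poweR (avg J (fun x => wpow (w x) (1 - conj_exp q))) (q - 1)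
   <= (delta^-1 * ((q - 1) / (q - delta)) `^ (q - 1))%:E)%E.
Proof.
move=> q1 dq; have [v [M [a [b [bv vM M0 ab [bJ wv V0 vRH]]]]]] := RHinfty_local.
rewrite (avg_model v a b bv ab bJ wv) conj_exp1B//.
have d0 : 0 < delta := lt_le_trans ltr01 d1.
set V := \int[mu]_(t in `]a, b[) v t in V0 *.
pose Lam := delta * V / (b - a); set p := (q - 1)^-1.
have p0 : 0 < p by rewrite invr_gt0 subr_gt0.
have ba : 0 < b - a by rewrite subr_gt0.
have pd : 0 < p + 1 - delta * p.
  have -> : p + 1 - delta * p = (q - delta) / (q - 1).
    by rewrite /p; field; rewrite subr_eq0 gt_eqF.
  by rewrite divr_gt0 ?subr_gt0.
have bound := int_power_bound v delta M a b bv vM M0 d1 ab vRH V0 p p0 pd.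
(* [G (v t)] is the integrand of [int_power_bound]. It agrees almost everywhere with the power of
   [w]: [v <= Lam] almost everywhere, and both are +oo at zeros. *)
pose G (s : R) := (if s == 0%R then +oo else (Num.min Lam s `^ (- p))%:E)%E.
have mG : measurable_fun [set: R] G.
  apply: measurable_fun_ifT.
  - by apply: measurable_fun_eqr; [exact: measurable_id|exact: measurable_cst].
  - exact: measurable_cst.
  - apply/measurable_EFinP; apply: (measurableT_comp (@measurable_powR R (- p))).
    by apply: measurable_minr; [exact: measurable_cst|exact: measurable_id].
have avgE : avg J (fun x => wpow (w x) (- p)) =
    ((b - a)^-1%:E * \int[mu]_(t in `]a, b[) G (v t))%E.
  apply: (avg_between J a b _ (fun t => G (v t)) ab bJ mJ).
  - exact: (measurableT_comp (measurable_wpow _) mwJ).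
  - exact: measurable_funTS (measurableT_comp mG (bmeas_measurable v bv)).
  - apply: negligibleS (negligibleU wv (negligible_Lam v a b bv ab vRH)) => t /=.
    move=> [tab wG]; have [wvt|] := eqVneq (w t) (v t); last by move=> /eqP; left.
    right; split=> //; rewrite ltNge; apply/negP => vL; apply: wG.
    by rewrite /wpow /G wvt oppr_lt0 p0 andbT; case: eqP => // _; rewrite min_r.
have avgle : (avg J (fun x => wpow (w x) (- p)) <=
    (Lam `^ (- p) / (p + 1 - delta * p))%:E)%E.
  rewrite avgE lee_pdivrMl//; apply: (le_trans bound).
  by rewrite -EFinM lee_fin [leRHS]mulrC mulrAC.
have avg0 : (0 <= avg J (fun x => wpow (w x) (- p)))%E.
  rewrite avgE mule_ge0 ?lee_fin ?invr_ge0 ?(ltW ba)//; apply: integral_ge0 => t _.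
  by rewrite /G; case: ifP => _; rewrite ?leey// lee_fin powR_ge0.
have powle := gt0_ler_poweR (ltW (_ : 0 < q - 1)).
apply: (@le_trans _ _ (((b - a)^-1 * V)%:E *
   ((Lam `^ (- p) / (p + 1 - delta * p))%:E `^ (q - 1)))%E).
  apply: lee_wpmul2l; first by rewrite lee_fin mulr_ge0 ?invr_ge0 ?(ltW ba) ?(ltW V0).
  apply: powle => //; rewrite ?subr_gt0// in_itv/= ?avg0 ?leey//.
  by rewrite lee_fin divr_ge0 ?powR_ge0// ltW.
by rewrite /= -EFinM lee_fin powR_const.
Qed.

Lemma Ainfty_le :
  (avg J (EFin \o w) * expeR (- avg J (fun x => lne (w x)%:E))
   <= (delta^-1 * expR (delta - 1))%:E)%E.
Proof.
have [v [M [a [b [bv vM M0 ab [bJ wv V0 vRH]]]]]] := RHinfty_local.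
rewrite (avg_model v a b bv ab bJ wv).
have d0 : 0 < delta := lt_le_trans ltr01 d1.
set V := \int[mu]_(t in `]a, b[) v t in V0 *.
pose Lam := delta * V / (b - a).
have ba : 0 < b - a by rewrite subr_gt0.
have L0 : 0 < Lam by rewrite divr_gt0// mulr_gt0.
have bound := int_ln_bound v delta M a b bv vM M0 d1 ab vRH V0.
(* [G] is nonnegative, so the bound [int_ln_bound] alone makes it integrable. Then ln w is almost
   everywhere the difference of the integrable functions ln Lam and [G (v t)], the value +oo of [G]
   matching [lne 0]. *)
pose G (s : R) := (if s == 0%R then +oo else (ln Lam - ln (Num.min Lam s))%:E)%E.
have mG : measurable_fun [set: R] G.
  apply: measurable_fun_ifT.
  - by apply: measurable_fun_eqr; [exact: measurable_id|exact: measurable_cst].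
  - exact: measurable_cst.
  - apply/measurable_EFinP; apply: measurable_funB; first exact: measurable_cst.
    apply: (measurableT_comp (@measurable_ln R)).
    by apply: measurable_minr; [exact: measurable_cst|exact: measurable_id].
have mab := measurable_lline_itv `]a, b[.
have mGv : measurable_fun (`]a, b[ : set T) (fun t : T => G (v t)).
  exact: measurable_funTS (measurableT_comp mG (bmeas_measurable v bv)).
have G0 t : (0 <= G (v t))%E.
  rewrite /G; case: eqP => // /eqP v0; rewrite lee_fin subr_ge0.
  have vt : 0 < v t by rewrite lt_neqAle eq_sym v0; case/andP: (vM t).
  by rewrite ler_ln ?posrE ?lt_min ?L0 ?vt// ge_min lexx.
have iG : mu.-integrable `]a, b[ (fun t => G (v t)).
  apply/integrableP; split; first exact: mGv.
  under eq_integral do rewrite gee0_abs//.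
  by apply: le_lt_trans bound _; rewrite ltry.
have ic : mu.-integrable `]a, b[ (EFin \o (fun=> ln Lam)) := bmeas_int _ _ _ (bmeas_cst _).
have avgE : avg J (fun x => lne (w x)%:E) =
    ((b - a)^-1%:E * \int[mu]_(t in `]a, b[) ((ln Lam)%:E - G (v t)))%E.
  apply: (avg_between J a b _ (fun t => (ln Lam)%:E - G (v t))%E ab bJ mJ).
  - exact: (measurableT_comp measurable_lne_EFin mwJ).
  - by apply: emeasurable_funB => //; exact: measurable_cst.
  - apply: negligibleS (negligibleU wv (negligible_Lam v a b bv ab vRH)) => t /=.
    move=> [tab wG]; have [wvt|] := eqVneq (w t) (v t); last by move=> /eqP; left.
    right; split=> //; rewrite ltNge; apply/negP => vL; apply: wG.
    rewrite /G wvt; case: eqP => [->|/eqP v0]; first by rewrite lexx.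
    have vt : 0 < v t by rewrite lt_neqAle eq_sym v0; case/andP: (vM t).
    by rewrite leNgt vt/= min_r// -EFinB subKr.
rewrite integralB// in avgE.
have fG := integrable_fin_num mab iG.
set g := fine (\int[mu]_(t in `]a, b[) G (v t))%E.
have gE : (\int[mu]_(t in `]a, b[) G (v t))%E = g%:E by rewrite fineK.
have gle : g <= (delta - 1) * (b - a) by rewrite -lee_fin -gE.
have avgR : avg J (fun x => lne (w x)%:E) = (ln Lam - g / (b - a))%:E.
  have cE : (\int[mu]_(t in `]a, b[) (ln Lam)%:E = (ln Lam * (b - a))%:E)%E.
    have fin := integrable_fin_num mab ic.
    by rewrite -(int_cst _ _ _ (ltW ab)); exact/esym/(fineK fin).
  rewrite avgE gE cE -EFinB -EFinM; congr (_%:E).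
  by field; rewrite gt_eqF.
have expE : expR (- (ln Lam - g / (b - a))) = expR (g / (b - a)) / Lam.
  by rewrite opprB expRD expRN lnK.
rewrite avgR -EFinN /= -EFinM lee_fin expE.
rewrite [leRHS](_ : _ = (b - a)^-1 * V * (expR (delta - 1) / Lam)).
  rewrite ler_wpM2l ?mulr_ge0 ?invr_ge0 ?(ltW ba) ?(ltW V0)//.
  by rewrite ler_pM2r ?invr_gt0// ler_expR ler_pdivrMr.
by rewrite /Lam; field; rewrite !gt_eqF.
Qed.
End upper_bound.

(** * Power weights *)

Section power_integral.
Context {R : realType}.
Notation T := (lebesgue_line R).
Notation mu := (@completed_lebesgue_measure R).
Variable a : R.

Definition pow_from (s t : R) : R := (t - a) `^ s.

Lemma measurable_pow_from s : measurable_fun [set: R] (pow_from s).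
Proof.
apply: (measurableT_comp (@measurable_powR R s)).
by apply: measurable_funB; [exact: measurable_id|exact: measurable_cst].
Qed.

Lemma measurable_pow_fromT s (D : set R) :
  measurable_fun (D : set T) (fun t : T => (pow_from s t)%:E).
Proof.
apply: measurable_funTS; apply: lebesgue_line_funT.
by apply/measurable_EFinP; exact: measurable_pow_from.
Qed.

Lemma is_derive_pow_from s t : a < t ->
  is_derive t 1 (pow_from s) (s * pow_from (s - 1) t).
Proof.
move=> at_; have t0 : 0 < shift (- a) t by rewrite /= subr_gt0.
have := is_derive1_comp (is_derive1_powR s t0) (is_derive_shift t 1 (- a)).
by rewrite mulr1.
Qed.

Lemma int_pow_from_cc s x y : -1 < s -> a < x -> x < y ->
  (\int[mu]_(t in `]x, y[) (pow_from s t)%:E =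
   ((pow_from (s + 1) y - pow_from (s + 1) x) / (s + 1))%:E)%E.
Proof.
move=> s1 ax xy; have s10 : s + 1 != 0 by rewrite gt_eqF// -ltrBlDr sub0r.
have mf : measurable_fun `]x, y[ (fun t : R => (pow_from s t)%:E).
  by apply: measurable_funTS; apply/measurable_EFinP; exact: measurable_pow_from.
rewrite integral_completed//; last by move=> t _; rewrite lee_fin powR_ge0.
rewrite -(integral_itv_bndoo true false mf).
pose F t := (s + 1)^-1 * pow_from (s + 1) t.
have dF t : a < t -> is_derive t 1 F (pow_from s t).
  move=> at_; have := is_deriveZ (s + 1)^-1 (is_derive_pow_from (s + 1) t at_).
  by rewrite addrK /GRing.scale/= mulrA mulVf// mul1r.
have Fc t : a < t -> F z @[z --> t] --> F t.
  move=> /dF [dFt _]; apply: differentiable_continuous.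
  exact/derivable1_diffP.
rewrite (@continuous_FTC2 _ _ F)//.
- by rewrite /F -EFinB -mulrBr mulrC.
- apply: derivable_within_continuous => t; rewrite in_itv/= => /andP[xt _].
  by have [] := is_derive_pow_from s t (lt_le_trans ax xt).
- split.
  + by move=> t; rewrite in_itv/= => /andP[xt _]; have [] := dF t (lt_trans ax xt).
  + exact: cvg_at_right_filter (Fc x ax).
  + exact: cvg_at_left_filter (Fc y (lt_trans ax xy)).
- move=> t; rewrite in_itv/= => /andP[xt _]; rewrite derive1E.
  by have [_] := dF t (lt_trans ax xt).
Qed.

Lemma pow_from_cvg0 r (e : nat -> R) : 0 < r -> (forall n, 0 < e n) ->
  e n @[n --> \oo] --> 0 -> pow_from r (a + e n) @[n --> \oo] --> 0.
Proof.
move=> r0 e0 ec; have /cvg_at_rightP/(_ e (conj e0 ec)) := powR_cvg0 r0.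
have -> // : (fun n => pow_from r (a + e n)) = (fun n => e n `^ r).
by apply/funext => n; rewrite /pow_from addrAC subrr add0r.
Qed.

Lemma int_pow_from s y : -1 < s -> a < y ->
  (\int[mu]_(t in `]a, y[) (pow_from s t)%:E = (pow_from (s + 1) y / (s + 1))%:E)%E.
Proof.
move=> s1 ay; have s10 : 0 < s + 1 by rewrite -ltrBlDr sub0r.
have ya : 0 < y - a by rewrite subr_gt0.
(* Starting at [n.+2] keeps [a + e n < y] for n = 0 as well, so that every truncated interval is
   non-degenerate. *)
pose e n : R := (y - a) / n.+2%:R.
have e0 n : 0 < e n by rewrite divr_gt0.
have ey n : a + e n < y.
  by rewrite -ltrBrDl ltr_pdivrMr// ltr_pMr// ltr1n.
have ec : e n @[n --> \oo] --> 0.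
  rewrite -(mulr0 (y - a)); apply: cvgMr.
  have := @cvg_harmonic R; rewrite -(cvg_shiftS) /=.
  exact.
pose F n : set R := `]a + e n, y[%classic.
have ndF : {homo F : n m / (n <= m)%N >-> (n <= m)%O}.
  move=> n m nm; apply/subsetPset => t; rewrite /F /= !in_itv/= => /andP[et ->].
  rewrite andbT (le_lt_trans _ et)// lerD2l ler_pM2l// lef_pV2 ?posrE ?ltr0n//.
  by rewrite ler_nat !ltnS.
have UF : \bigcup_n F n = `]a, y[%classic.
  apply/seteqP; split=> t.
    by move=> [n _]; rewrite /F /= !in_itv/= => /andP[et ->]; rewrite andbT (lt_trans _ et)// ltrDl.
  rewrite /= in_itv/= => /andP[at_ ty].
  have : \forall n \near \oo, e n < t - a.
    by move/cvgr_lt : ec; apply; rewrite subr_gt0.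
  move=> [N _ /(_ N (leqnn N)) /= eN]; exists N => //.
  by rewrite /F /= in_itv/= ty andbT -ltrBrDl.
have cvgI := @ge0_nondecreasing_set_cvg_integral _ T _ F (fun t => (pow_from s t)%:E) mu ndF
  (fun n => measurable_lline_itv _) (fun n => measurable_pow_fromT s (F n))
  (fun n t _ => powR_ge0 _ _).
rewrite -UF; apply: (cvg_unique _ cvgI) => //=.
under eq_fun do rewrite (int_pow_from_cc s _ _ s1 _ (ey _)) ?ltrDl//.
apply: cvg_EFin; first by near=> n.
rewrite /comp/=; apply: cvgMl; rewrite -[X in _ --> X]subr0; apply: cvgB; first exact: cvg_cst.
exact: pow_from_cvg0.
Unshelve. all: by end_near. Qed.
End power_integral.

(** * Lower bounds from power weights *)

Section sharpness.
Context {R : realType}.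
Notation T := (lebesgue_line R).
Notation mu := (@completed_lebesgue_measure R).
Variables (I : set R) (a b : R).
Hypotheses (HI : bounded_interval I) (ab : a < b) (bI : between a b I).
Notation w d := (pow_from a (d - 1)).

(** If x were less than a, the midpoint of x and [Num.min a y] would be a point of [J] to the left
    of [I]; similarly on the right. *)
Lemma between_sub (J : set R) x y : x < y -> between x y J -> J `<=` I -> a <= x /\ y <= b.
Proof.
move=> xy [xyJ _] JI; have sub t : x < t -> t < y -> a <= t <= b.
  by move=> xt ty; have := bI.2 _ (JI t (xyJ t _)); rewrite /= !in_itv/= xt ty; apply.
split; rewrite leNgt; apply/negP => lt.
- have /andP[] : a <= (x + Num.min a y) / 2 <= b.
    by apply: sub; rewrite ?ltr_pdivlMr// ?ltr_pdivrMr// mulr_natr mulr2n; [rewrite ltrD2l lt_min lt xy|rewrite ltr_leD// ge_min lexx orbT].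
  rewrite leNgt ltr_pdivrMr// mulr_natr mulr2n; rewrite ltr_leD//.
  by rewrite ge_min lexx.
- have /andP[_] : a <= (y + Num.max b x) / 2 <= b.
    by apply: sub; rewrite ?ltr_pdivlMr// ?ltr_pdivrMr// mulr_natr mulr2n; [rewrite ltr_leD// le_max lexx orbT|rewrite ltrD2l gt_max lt xy].
  rewrite leNgt ltr_pdivlMr// mulr_natr mulr2n; rewrite ltr_leD//.
  by rewrite le_max lexx.
Qed.

Lemma avg_pow_between (J : set R) x y s (f : R -> \bar R) : x < y -> between x y J ->
  measurable (J : set T) -> -1 < s -> a <= x ->
  measurable_fun (J : set T) (f : T -> \bar R) ->
  (forall t, x < t -> t < y -> f t = (pow_from a s t)%:E) ->
  avg J f = ((y - x)^-1 * ((pow_from a (s + 1) y - pow_from a (s + 1) x) / (s + 1)))%:E.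
Proof.
move=> xy bJ mJ s1 ax mf fE.
rewrite (avg_between J x y _ (fun t => (pow_from a s t)%:E) xy bJ mJ mf).
- rewrite EFinM; congr (_ * _)%E; move: ax; rewrite le_eqVlt => /predU1P[ax|ax].
    rewrite -ax int_pow_from ?ax//; congr (_%:E); rewrite {3}/pow_from subrr powR0 ?subr0//.
    by rewrite gt_eqF// -ltrBlDr sub0r.
  exact: int_pow_from_cc.
- exact: measurable_pow_fromT.
- exists set0; split=> // t /= [+ ne]; rewrite in_itv/= => /andP[xt ty].
  by apply: ne; exact: fE.
Qed.

(** The weight is nondecreasing, so its values on [J] are at most Y^(d-1), where X = x - a and Y = y
    - a. Now d times the average is (Y^d - X^d)/(Y - X), and X^d <= X Y^(d-1) makes this at least
    Y^(d-1). *)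
Lemma RHinfty_pow d delta : 1 <= d -> d <= delta -> RHinfty I delta (w d).
Proof.
move=> d1 dd; have d0 : 0 < d := lt_le_trans ltr01 d1.
split; first by split=> [|t _]; [apply: measurable_funTS; apply: lebesgue_line_funT; exact: measurable_pow_from|exact: powR_ge0].
move=> J [HJ JI]; have [x [y [xy bJ]]] := bounded_interval_between _ HJ.
have [ax yb] := between_sub J x y xy bJ JI.
have mJ := measurable_bounded_interval _ HJ.
have s1 : -1 < d - 1 by rewrite ltrBrDl subrr.
have -> : avg J (EFin \o w d) = ((y - x)^-1 * ((pow_from a d y - pow_from a d x) / d))%:E.
  rewrite (avg_pow_between J x y _ _ xy bJ mJ s1 ax) ?subrK//.
  exact: measurable_pow_fromT.
have yx : 0 < y - x by rewrite subr_gt0.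
have ya : 0 < y - a by rewrite subr_gt0 (le_lt_trans ax).
set A := _ * (_ / _).
have YA : pow_from a (d - 1) y <= d * A.
  have -> : d * A = (y - x)^-1 * (pow_from a d y - pow_from a d x).
    by rewrite /A mulrCA [d * _]mulrC divfK// gt_eqF.
  rewrite ler_pdivlMl//.
  have xa : 0 <= x - a by rewrite subr_ge0.
  have -> : pow_from a d y = (y - a) * pow_from a (d - 1) y.
    by rewrite /pow_from mulr_powRB1// ltW.
  have : pow_from a d x <= (x - a) * pow_from a (d - 1) y.
    rewrite -[leLHS](_ : (x - a) * pow_from a (d - 1) x = _).
      apply: ler_wpM2l => //; apply: ge0_ler_powR; rewrite ?nnegrE ?subr_ge0//.
        exact: ltW (le_lt_trans ax xy).
      by rewrite lerD2r ltW.
    by rewrite /pow_from mulr_powRB1.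
  move=> h; rewrite lerBrDr -lerBrDl -mulrBl; apply: (le_trans h).
  by rewrite (_ : y - a - (y - x) = x - a)// opprB addrC addrA subrK.
have A0 : 0 < A by rewrite -(pmulr_rgt0 _ d0) (lt_le_trans _ YA)// powR_gt0.
split; first by rewrite lte_fin A0 ltry.
rewrite inver gt_eqF// lee_pdivrMr// -EFinM; apply/ess_supP/nearW => t.
rewrite /patch; case: ifPn => [/set_mem Jt|_]; last exact: leNye.
rewrite lee_fin /=.
apply: le_trans (_ : d * A <= delta * A); last by rewrite ler_pM2r.
apply: le_trans YA; apply: ge0_ler_powR.
- by rewrite subr_ge0.
- rewrite nnegrE subr_ge0; have := bI.2 _ (JI _ Jt).
  by rewrite /= in_itv/= => /andP[].
- by rewrite nnegrE ltW.
- by rewrite lerD2r; have := bJ.2 _ Jt; rewrite /= in_itv/= => /andP[].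
Qed.
Let mI : measurable (I : set T) := measurable_bounded_interval _ HI.

Let ba0 : 0 < b - a. Proof. by rewrite subr_gt0. Qed.

Lemma avg_pow d : 1 <= d -> avg I (EFin \o w d) = ((b - a) `^ (d - 1) / d)%:E.
Proof.
move=> d1; have s1 : -1 < d - 1 by rewrite ltrBrDl subrr (lt_le_trans ltr01).
have d0 : 0 < d := lt_le_trans ltr01 d1.
rewrite (avg_pow_between I a b _ _ ab bI mI s1 (lexx a))//.
  congr (_%:E); rewrite subrK {2}/pow_from subrr powR0 ?gt_eqF// subr0 mulrA; congr (_ / _).
  by rewrite /pow_from -(mulr_powRB1 (ltW ba0) d0) mulKf// gt_eqF.
exact: measurable_pow_fromT.
Qed.

(** The conjugate power of the weight has exponent [s] with s + 1 = (q - d)/(q - 1), so [d < q] is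
    precisely its integrability at a. *)
Lemma Aq_sup_pow d q : 1 <= d -> 1 < q -> d < q ->
  ((d^-1 * ((q - 1) / (q - d)) `^ (q - 1))%:E <= Aq_sup I q (w d))%E.
Proof.
move=> d1 q1 dq; have d0 : 0 < d := lt_le_trans ltr01 d1.
have qp : 0 < q - 1 by rewrite subr_gt0.
have qd : 0 < q - d by rewrite subr_gt0.
apply: ereal_sup_ubound; exists I; first by split.
rewrite avg_pow// conj_exp1B//; set s := (d - 1) * - (q - 1)^-1.
have sE : s + 1 = (q - d) / (q - 1) by rewrite /s; field; rewrite gt_eqF.
have s1 : -1 < s by rewrite -subr_gt0 opprK sE divr_gt0.
have s10 : 0 < s + 1 by rewrite sE divr_gt0.
rewrite (avg_pow_between I a b s _ ab bI mI s1 (lexx a)).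
- rewrite {2}/pow_from subrr powR0 ?gt_eqF// subr0.
  have -> : (b - a)^-1 * (pow_from a (s + 1) b / (s + 1)) = (b - a) `^ s / (s + 1).
    rewrite mulrA; congr (_ / _).
    by rewrite /pow_from -(mulr_powRB1 (ltW ba0) s10) mulKf ?gt_eqF// addrK.
  rewrite /= -EFinM; congr (_%:E).
  have si0 : 0 <= (s + 1)^-1 by rewrite invr_ge0 ltW.
  rewrite (powRM _ (powR_ge0 _ _) si0) -powRrM.
  have -> : s * (q - 1) = - (d - 1) by rewrite /s; field; rewrite gt_eqF.
  rewrite sE invf_div mulrA powRN; congr (_ * _).
  by field; rewrite !gt_eqF// powR_gt0.
- apply: (measurableT_comp (measurable_wpow _)); apply: measurable_funTS.
  by apply: lebesgue_line_funT; exact: measurable_pow_from.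
- move=> t at_ tb; have t0 : 0 < t - a by rewrite subr_gt0.
  by rewrite /wpow gt_eqF ?powR_gt0//= /pow_from -powRrM.
Qed.

(** Positive and negative parts are compared separately, so no integrability is assumed; the lemma
    is applied to the logarithm of the weight. *)
Lemma integral_mono (D : set R) (f g : R -> \bar R) : measurable (D : set T) ->
  measurable_fun (D : set T) (f : T -> \bar R) ->
  measurable_fun (D : set T) (g : T -> \bar R) ->
  (forall t, D t -> (f t <= g t)%E) ->
  (\int[mu]_(t in D) f t <= \int[mu]_(t in D) g t)%E.
Proof.
move=> mD mf mg fg; rewrite integralE [leRHS]integralE; apply: leeB.
- apply: ge0_le_integral => //.
  + exact: measurable_funepos.
  + exact: measurable_funepos.
  + by move=> t /mem_set; apply: funepos_le => z /set_mem; exact: fg.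
- apply: ge0_le_integral => //.
  + exact: measurable_funeneg.
  + exact: measurable_funeneg.
  + by move=> t /mem_set; apply: funeneg_le => z /set_mem; exact: fg.
Qed.

(* Reduces the upper bound on the average of the logarithm to power integrals. *)
Lemma ln_le_powR (L u e : R) : 0 < L -> 0 < u -> 0 < e ->
  ln u <= ln L - e^-1 + (L `^ (- e) / e) * u `^ e.
Proof.
move=> L0 u0 e0; have x0 : 0 < L `^ (- e) * u `^ e by rewrite mulr_gt0// powR_gt0.
have := @le_ln1Dx R (L `^ (- e) * u `^ e - 1).
rewrite subrKC lnM ?posrE ?powR_gt0// !ln_powR => H.
have {}H := H _; rewrite -(ler_pM2l e0).
have -> : e * (ln L - e^-1 + L `^ (- e) / e * u `^ e) =
    e * ln L + (L `^ (- e) * u `^ e - 1) by field; rewrite gt_eqF.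
by rewrite -lerBlDl addrC -mulNr; apply: H; rewrite ltrBrDr addNr.
Qed.

(** The average of the logarithm is not computed but bounded through [ln_le_powR]. The average of (t
    - a)^e is L^e/(e + 1), so - 1/e becomes - 1/e + 1/(e(e + 1)) = - 1/(e + 1). The sharp constant
    appears as [e] tends to 0. *)
Lemma Ainfty_sup_pow delta e : 1 <= delta -> 0 < e ->
  ((delta^-1 * expR ((delta - 1) / (1 + e)))%:E <= Ainfty_sup I (w delta))%E.
Proof.
move=> d1 e0; have d0 : 0 < delta := lt_le_trans ltr01 d1.
have dm0 : 0 <= delta - 1 by rewrite subr_ge0.
apply: (@le_trans _ _ (avg I (EFin \o w delta) *
    expeR (- avg I (fun x => lne (w delta x)%:E)))%E); last first.
  by apply: ereal_sup_ubound; exists I => //; split.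
have e1 : -1 < e by apply: lt_trans e0; rewrite ltrN10.
have e10 : 0 < e + 1 by rewrite addr_gt0.
set L := b - a; have L0 : 0 < L := ba0.
pose A := (delta - 1) * (ln L - e^-1); pose B := (delta - 1) * (L `^ (- e) / e).
have mab := measurable_lline_itv `]a, b[.
have mpow := measurable_pow_fromT a e `]a, b[.
have ip : mu.-integrable `]a, b[ (fun t => (pow_from a e t)%:E).
  apply/integrableP; split; first exact: mpow.
  under eq_integral do rewrite gee0_abs ?lee_fin ?powR_ge0//.
  by rewrite (int_pow_from a e b e1 ab) ltry.
have iA : mu.-integrable `]a, b[ (EFin \o (fun=> A)) := bmeas_int _ _ _ (bmeas_cst _).
have iB := integrableZl mab B ip.
have mlne : measurable_fun (setT : set T) (fun t : T => lne (w delta t)%:E).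
  apply: lebesgue_line_funT; apply: (measurableT_comp measurable_lne_EFin).
  exact: measurable_pow_from.
have avgle : (avg I (fun x => lne (w delta x)%:E) <= ((delta - 1) * (ln L - (e + 1)^-1))%:E)%E.
  rewrite (avg_between I a b _ (fun t => lne (w delta t)%:E) ab bI mI);
    [|exact: measurable_funTS..|by exists set0; split=> // t [_]].
  rewrite lee_pdivrMl//.
  apply: (@le_trans _ _ (\int[mu]_(t in `]a, b[) (A%:E + B%:E * (pow_from a e t)%:E)))%E.
    apply: integral_mono; [exact: mab|exact: measurable_funTS mlne| |].
      by apply: emeasurable_funD; [exact: measurable_cst|apply: measurable_funeM].
    move=> t tab; have /andP[at_ tb] : a < t < b by move: tab; rewrite /= in_itv.
    have t0 : 0 < t - a by rewrite subr_gt0.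
    rewrite lne_EFin ?powR_gt0// -EFinM -EFinD lee_fin /pow_from ln_powR.
    rewrite /A /B -mulrA -mulrDr ler_wpM2l//; exact: ln_le_powR.
  have cE : (\int[mu]_(t in `]a, b[) A%:E = (A * L)%:E)%E.
    have fin := integrable_fin_num mab iA.
    by rewrite -(int_cst _ _ _ (ltW ab)); exact/esym/(fineK fin).
  rewrite (integralD mab iA iB) (integralZl mab ip) cE (int_pow_from a e b e1 ab).
  rewrite -EFinM -EFinD -EFinM lee_fin /A /B /pow_from -/L.
  rewrite (powRD (x := L)) ?(gt_eqF L0) ?implybT// powRr1 ?(ltW L0)//.
  rewrite le_eqVlt; apply/orP; left; apply/eqP; rewrite powRN.
  by field; rewrite !gt_eqF// powR_gt0.
rewrite avg_pow//.
apply: (@le_trans _ _ (((L `^ (delta - 1) / delta)%:E *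
    expeR (- ((delta - 1) * (ln L - (e + 1)^-1))%:E)))%E).
  rewrite -EFinN /= -EFinM lee_fin.
  have -> : - ((delta - 1) * (ln L - (e + 1)^-1)) =
      (delta - 1) / (1 + e) - ln (L `^ (delta - 1)).
    by rewrite ln_powR [1 + e]addrC; ring.
  rewrite expRD expRN lnK ?posrE ?powR_gt0// le_eqVlt; apply/orP; left; apply/eqP.
  by field; rewrite !gt_eqF// powR_gt0.
apply: lee_wpmul2l; first by rewrite lee_fin divr_ge0 ?powR_ge0// ltW.
by rewrite lee_expeR leeN2.
Qed.
End sharpness.

Lemma Cq_unbounded (R : realType) (q k : R) : 1 < q -> 0 < k ->
  exists2 d, 1 <= d < q & k < d^-1 * ((q - 1) / (q - d)) `^ (q - 1).
Proof.
move=> q1 k0; have qp : 0 < q - 1 by rewrite subr_gt0.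
have q0 : 0 < q := lt_trans ltr01 q1.
(* [d] is chosen so that (q - 1)/(q - d) = m + 1, where m^(q-1) = k q. The factor q pays for 1/d >
   1/q; the added 1 gives both [1 <= d] and the strict inequality. *)
pose m := (k * q) `^ (q - 1)^-1; have m0 : 0 < m by apply/powR_gt0/mulr_gt0.
have m10 : 0 < m + 1 by rewrite addr_gt0.
have step : 0 < (q - 1) / (m + 1) by rewrite divr_gt0.
pose d := q - (q - 1) / (m + 1).
have dq : d < q by rewrite /d gtrBl.
have d1 : 1 <= d by rewrite /d lerBrDl -lerBrDr ler_pdivrMr// ler_peMr ?(ltW qp)// lerDr ltW.
have d0 : 0 < d := lt_le_trans ltr01 d1.
exists d; first by rewrite d1.
have -> : (q - 1) / (q - d) = m + 1.
  by rewrite /d subKr invf_div mulrC divfK// gt_eqF.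
have kq : k * q < (m + 1) `^ (q - 1).
  rewrite -[ltLHS](_ : m `^ (q - 1) = _).
    by apply: gt0_ltr_powR => //; rewrite ?nnegrE ?ltrDl// ltW.
  by rewrite /m -powRrM mulVf ?gt_eqF// powRr1// ltW// mulr_gt0.
rewrite -ltr_pdivrMl ?invr_gt0// invrK; apply: le_lt_trans kq.
by rewrite mulrC ler_pM2l// ltW.
Qed.

(** An explicit rate for the limit x -> 0, from m/(1 + x) >= m - m x and exp(- m x) >= 1 - m x. *)
Lemma expR_div1D (R : realType) (m x : R) : 0 <= m -> 0 < x ->
  expR m * (1 - m * x) <= expR (m / (1 + x)).
Proof.
move=> m0 x0; have x10 : 0 < 1 + x by rewrite addr_gt0.
apply: (@le_trans _ _ (expR m * expR (- (m * x)))).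
  by rewrite ler_pM2l ?expR_gt0// expR_ge1Dx.
rewrite -expRD ler_expR ler_pdivlMr// -subr_ge0.
have -> : m - (m - m * x) * (1 + x) = m * x ^+ 2 by ring.
by rewrite mulr_ge0// sqr_ge0.
Qed.

(** * Suprema and optimality of the constants *)

Section main.
Context {R : realType}.
Variables (I : set R) (delta : R).
Hypotheses (HI : bounded_interval I) (Hdelta : 1 <= delta).

Lemma Aq_sup_le w q : RHinfty I delta w -> 1 < q -> (Aq_sup I q w <= Cq q delta)%E.
Proof.
move=> Hw q1; rewrite /Cq; case: ifPn => [_|]; first exact: leey.
rewrite -ltNge => dq; apply: ge_ereal_sup => _ [J IJ <-].
exact: (Aq_le I delta w J HI Hdelta Hw IJ q q1 dq).
Qed.

Lemma Ainfty_sup_le w : RHinfty I delta w -> (Ainfty_sup I w <= Cinfty delta)%E.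
Proof.
move=> Hw; apply: ge_ereal_sup => _ [J IJ <-].
exact: (Ainfty_le I delta w J HI Hdelta Hw IJ).
Qed.

Lemma Cq_sharp q c : 1 < q ->
  (forall w, RHinfty I delta w -> (Aq_sup I q w <= c)%E) -> (Cq q delta <= c)%E.
Proof.
move=> q1 bound; have [a [b [ab bI]]] := bounded_interval_between _ HI.
have lower d : 1 <= d -> d <= delta -> d < q ->
    ((d^-1 * ((q - 1) / (q - d)) `^ (q - 1))%:E <= c)%E.
  move=> d1 dd dq; apply: le_trans (bound _ (RHinfty_pow I a b bI d delta d1 dd)).
  exact: Aq_sup_pow HI ab bI d q d1 q1 dq.
rewrite /Cq; case: ifPn => [qd|]; last first.
  by rewrite -ltNge => dq; exact: lower.
rewrite leNgt; apply/negP => cy.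
(* The case d = 1 shows [c >= 0]; together with [c < +oo] this makes [c] a real number that
   [Cq_unbounded] can exceed. *)
have c0 : (0 <= c)%E.
  by apply: le_trans (lower 1 (lexx _) Hdelta q1); rewrite lee_fin mulr_ge0 ?powR_ge0.
have cE : c = (fine c)%:E by rewrite fineK// ge0_fin_numE.
have k0 : 0 < fine c + 1 by rewrite ltr_wpDl// fine_ge0.
have [d /andP[d1 dq] kd] := Cq_unbounded _ _ _ q1 k0.
have := lower d d1 (le_trans (ltW dq) qd) dq; rewrite cE lee_fin leNgt.
by rewrite (lt_trans _ kd)// ltrDl.
Qed.

Lemma Cinfty_sharp c :
  (forall w, RHinfty I delta w -> (Ainfty_sup I w <= c)%E) -> (Cinfty delta <= c)%E.
Proof.
move=> bound; have [a [b [ab bI]]] := bounded_interval_between _ HI.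
have d0 : 0 < delta := lt_le_trans ltr01 Hdelta.
(* Taking the exponent [e / k] in [Ainfty_sup_pow] loses at most C (delta - 1) e/k <= e. The summand
   1 keeps [k] positive when delta = 1. *)
pose C := delta^-1 * expR (delta - 1); pose k := C * (delta - 1) + 1.
have C0 : 0 < C by rewrite mulr_gt0 ?invr_gt0 ?expR_gt0.
have k0 : 0 < k by rewrite ltr_wpDl// mulr_ge0 ?(ltW C0)// subr_ge0.
apply/lee_addgt0Pr => e e0; rewrite -leeBlDr//.
have ek : 0 < e / k by rewrite divr_gt0.
apply: le_trans (bound _ (RHinfty_pow I a b bI delta delta Hdelta (lexx _))).
apply: le_trans (Ainfty_sup_pow I a b HI ab bI delta _ Hdelta ek).
rewrite /Cinfty -EFinB lee_fin -/C.
have dm0 : 0 <= delta - 1 by rewrite subr_ge0.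
have dV0 : 0 < delta^-1 by rewrite invr_gt0.
have h := expR_div1D _ _ _ dm0 ek; rewrite -(ler_pM2l dV0) in h.
apply: le_trans h; rewrite [leRHS]mulrA -/C mulrBr mulr1 lerD2l lerN2 mulrA.
by rewrite mulrA ler_pdivrMr// mulrC ler_pM2l// lerDl.
Qed.
End main.

Local Open Scope ereal_scope.

Theorem theorem2 (R : realType) (I : set R) (delta : R)
    (HI : bounded_interval I) (Hdelta : (1 <= delta)%R) :
  (forall w : R -> R, RHinfty I delta w ->
     (forall q : R, (1 < q)%R -> Aq_sup I q w <= Cq q delta) /\
     Ainfty_sup I w <= Cinfty delta)
  /\
  (forall q : R, (1 < q)%R -> forall c : \bar R, c < Cq q delta ->
     ~ (forall w : R -> R, RHinfty I delta w -> Aq_sup I q w <= c))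
  /\
  (forall c : \bar R, c < Cinfty delta ->
     ~ (forall w : R -> R, RHinfty I delta w -> Ainfty_sup I w <= c)).
Proof.
split=> [w Hw|]; first by split=> [q q1|]; [exact: Aq_sup_le|exact: Ainfty_sup_le].
split=> [q q1 c cC bound|c cC bound]; move: cC; rewrite ltNge => /negP; apply.
  exact: Cq_sharp I delta HI Hdelta q c q1 bound.
exact: Cinfty_sharp I delta HI Hdelta c bound.
Qed.
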